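(* Let $K$ be a field with $\mathbb{Q} \subseteq K \subseteq \mathbb{R}$ and let $n \geq 2$. Any colouring of the graph $T_{K^n}$ by Lebesgue measurable colour sets requires at least $n+3$ colours; that is, $\chi_m(T_{K^n}) \geq n+3$.
   Context: For a field $K$ with $\mathbb{Q} \subseteq K \subseteq \mathbb{R}$ and $n\ge 2$, the graph $T_{K^n}$ has vertex set $\mathbb{R}^n$, and two vertices $x,y$ are joined by an edge iff $y-x \in K^n$ and $y-x$ has Euclidean norm $1$. A colouring is a partition of the vertex set into colour sets, none of which contains two adjacent vertices. The measurable chromatic number $\chi_m$ of such a graph is the least number of colours in a colouring all of whose colour sets are Lebesgue measurable subsets of $\mathbb{R}^n$. *)

(* Defs.v *)
From mathcomp Require Import all_boot all_order all_algebra.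
From mathcomp Require Import all_classical all_reals all_analysis.

Set Implicit Arguments.
Unset Strict Implicit.
Unset Printing Implicit Defensive.

Import Order.TTheory GRing.Theory Num.Theory.

Local Open Scope classical_set_scope.
Local Open Scope ring_scope.

(* The library norm `|x| on 'rV[R]_n is the sup norm, hence the definition
   below. *)
Definition euclidean_norm {R : realType} {n : nat} (x : 'rV[R]_n) : R :=
  Num.sqrt (\sum_i x 0 i ^+ 2).

Section lebesgue_measurability.
Context {R : realType} {n : nat}.
Implicit Types (a b : 'rV[R]_n) (A : set 'rV[R]_n).

Definition box a b : set 'rV[R]_n :=
  [set x | forall i, a 0 i < x 0 i <= b 0 i].

(* The maximum with 0 covers the degenerate boxes, where some b_i <= a_i. *)
Definition box_volume a b : R := \prod_i Num.max 0 (b 0 i - a 0 i).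

Definition lebesgue_outer_measure A : \bar R :=
  ereal_inf [set (\sum_(0 <= k <oo) (box_volume (ab k).1 (ab k).2)%:E)%E |
             ab in [set ab : nat -> 'rV[R]_n * 'rV[R]_n |
                    A `<=` \bigcup_k box (ab k).1 (ab k).2]].

(* All Lebesgue measurable sets, not only the Borel ones. *)
Definition lebesgue_measurable A : Prop :=
  lebesgue_outer_measure.-caratheodory A.

End lebesgue_measurability.

Definition coloring (V : Type) (adj : V -> V -> Prop) (C : set (set V)) :=
  partition C id [set: V] /\
  forall c, C c -> forall x y, c x -> c y -> ~ adj x y.

Definition T_adj {R : realType} {n : nat} (K : {pred R}) (x y : 'rV[R]_n) :
    Prop :=
  y - x \is a mxOver K /\ euclidean_norm (y - x) = 1.

Definition measurable_coloring {R : realType} {n : nat}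
    (adj : 'rV[R]_n -> 'rV[R]_n -> Prop) (C : set (set 'rV[R]_n)) :=
  coloring adj C /\ forall c, C c -> lebesgue_measurable c.

(* An extended real: counting C is the number of elements of C, or +oo if C is
   infinite. *)
Definition measurable_chromatic_number {R : realType} {n : nat}
    (adj : 'rV[R]_n -> 'rV[R]_n -> Prop) : \bar R :=
  ereal_inf [set counting C | C in measurable_coloring adj].

(* Main.v *)
Require Import Defs.
From HB Require Import structures.
From mathcomp Require Import all_boot all_order all_algebra.
From mathcomp Require Import all_classical all_reals all_analysis.
From mathcomp Require Import measurable_realfun.
From mathcomp Require Import ring lra.

(** A colouring of the rational unit-distance graph with measurable classes is,
up to null sets, a colouring of the full unit-distance graph: the measure of
[E `&` (E + v)] in a bounded region depends continuously on [v], and rational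
unit vectors are dense in the sphere.

Suppose n + 2 colours suffice, and let [flip u] be the set of points x whose
colour differs from that of x + u. It has positive measure for arbitrarily
small u, while its measure in a bounded region tends to 0 with u. Fix a finite
configuration of unit vectors and move it by n one-parameter families of
isometries. If around almost every point of [flip u] every moved copy met
[flip u] again, then n consecutive steps would lead from [flip u] to [flip u];
as the sums of n steps fill out an n-dimensional region, [flip u] could not be
small. Hence some x in [flip u] has a copy of the configuration around it that
avoids [flip u], so that none of its unit vectors uses either of the two colours
of x and x + u: the centre is bichromatic.

No (n + 2)-colouring admits a bichromatic centre. For n > 2, n unit vectors
that form a regular simplex with the centre use up the n remaining colours, so
the mirror image of the centre has one of the two colours of the centre; three
such mirror images can be placed at mutual distance 1. For n = 2 a configuration
of 27 points in the lattice generated by the sixth roots of unity and a unit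
number of real part 5/6 is checked exhaustively. *)

Import Order.TTheory GRing.Theory Num.Theory.
Import numFieldNormedType.Exports.

Set Implicit Arguments.
Unset Strict Implicit.
Unset Printing Implicit Defensive.

Local Open Scope classical_set_scope.
Local Open Scope ring_scope.

(** * Lebesgue outer measure *)

Lemma expansion_of_cover (R : realType) (n : nat) (A : set 'rV[R]_n) (x : \bar R) :
  (lebesgue_outer_measure A < x)%E ->
  exists ab : nat -> 'rV[R]_n * 'rV[R]_n,
    A `<=` \bigcup_k box (ab k).1 (ab k).2 /\
    (\sum_(0 <= k <oo) (box_volume (ab k).1 (ab k).2)%:E < x)%E.
Proof. by move=> /ereal_inf_lt[_ [ab Aab <-] abx]; exists ab. Qed.

Section outer_measure.
Context {R : realType} {n : nat}.
Implicit Types (a b : 'rV[R]_n.+1) (A B : set 'rV[R]_n.+1).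
Local Notation mu := (@lebesgue_outer_measure R n.+1).

Lemma box_volume_ge0 a b : 0 <= box_volume a b.
Proof. by apply: prodr_ge0 => i _; rewrite le_max lexx. Qed.

Lemma box_volumexx a : box_volume a a = 0.
Proof. by rewrite /box_volume big_ord_recl subrr maxxx mul0r. Qed.

Lemma lebesgue_outer_measure_ge0 A : (0 <= mu A)%E.
Proof.
apply: le_ereal_inf_tmp => _ [ab _ <-].
by apply: nneseries_ge0 => k _ _; rewrite lee_fin box_volume_ge0.
Qed.

Lemma lebesgue_outer_measure_le (ab : nat -> 'rV[R]_n.+1 * 'rV[R]_n.+1) A :
  A `<=` \bigcup_k box (ab k).1 (ab k).2 ->
  (mu A <= \sum_(0 <= k <oo) (box_volume (ab k).1 (ab k).2)%:E)%E.
Proof. by move=> Aab; apply: ereal_inf_lbound; exists ab. Qed.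

Lemma lebesgue_outer_measure0 : mu set0 = 0%E.
Proof.
apply/eqP; rewrite eq_le lebesgue_outer_measure_ge0 andbT.
apply: (le_trans (lebesgue_outer_measure_le (ab := fun=> (0, 0)) _)) => //.
by rewrite eseries0 // => k _ _ /=; rewrite box_volumexx.
Qed.

Lemma lebesgue_outer_measure_subset A B : A `<=` B -> (mu A <= mu B)%E.
Proof.
move=> AB; apply: ereal_inf_le_tmp => _ [ab Bab <-]; exists ab => //.
exact: subset_trans Bab.
Qed.

(** Covers of the [A k] that exceed the infimum by less than e / 2^(k+1) are merged into a single
    sequence of boxes along a bijection of nat with nat * nat. *)
Lemma lebesgue_outer_measure_sigma_subadditive : sigma_subadditive mu.
Proof.
move=> A; have [[i Ai]|] := pselect (exists i, mu (A i) = +oo%E).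
  rewrite (eseries_pinfty _ _ Ai) ?leey// => k _.
  by rewrite gt_eqF// (lt_le_trans _ (lebesgue_outer_measure_ge0 _)).
rewrite -forallNE => Aoo.
apply/lee_addgt0Pr => e e0.
apply: le_trans (epsilon_trick _ (fun k => lebesgue_outer_measure_ge0 _) (ltW e0)).
have /choice[G AG] k : exists ab : nat -> 'rV[R]_n.+1 * 'rV[R]_n.+1,
    A k `<=` \bigcup_j box (ab j).1 (ab j).2 /\
    (\sum_(0 <= j <oo) (box_volume (ab j).1 (ab j).2)%:E
      < mu (A k) + (e / (2 ^ k.+1)%:R)%:E)%E.
  apply: expansion_of_cover; rewrite lteDl ?lte_fin ?divr_gt0 ?ltr0n ?expn_gt0//.
  by rewrite ge0_fin_numE ?lebesgue_outer_measure_ge0// ltey; apply/eqP/Aoo.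
have /card_esym/ppcard_eqP[f] := card_nat2.
pose ab k := uncurry G (f k).
apply: (le_trans (lebesgue_outer_measure_le (ab := ab) _)).
  move=> x [k _ /(AG k).1[j _ xj]].
  by exists (f^-1%FUN (k, j)) => //=; rewrite /ab invK ?inE.
have vol0 (x : nat * nat) :
    (0 <= (box_volume (uncurry G x).1 (uncurry G x).2)%:E)%E.
  by rewrite lee_fin box_volume_ge0.
rewrite nneseries_esumT; last by move=> k; exact: vol0.
rewrite -(@reindex_esum R nat (nat * nat)%type [set: nat] [set: nat * nat] f
  (fun x => (box_volume (uncurry G x).1 (uncurry G x).2)%:E)); last first.
  by rewrite setTT_bijective; exists f^-1%FUN => x; rewrite ?funK ?invK ?inE.
have -> : (\esum_(x in [set: nat * nat])
      (box_volume (uncurry G x).1 (uncurry G x).2)%:E =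
    \esum_(i in [set: nat]) \esum_(j in [set: nat])
      (box_volume (G i j).1 (G i j).2)%:E)%E.
  rewrite esum_esum; last by move=> i j _ _; exact: (vol0 (i, j)).
  rewrite (_ : [set: nat] `*`` (fun=> [set: nat]) = [set: nat * nat]).
    by apply: eq_esum => -[].
  by apply/seteqP; split => -[].
rewrite -nneseries_esumT; last first.
  by move=> k; apply: esum_ge0 => j _; exact: (vol0 (k, j)).
apply: lee_nneseries => [k _ _|k _].
  by apply: esum_ge0 => j _; exact: (vol0 (k, j)).
rewrite -nneseries_esumT; last by move=> j; exact: (vol0 (k, j)).
exact/ltW/(AG k).2.
Qed.

HB.instance Definition _ := isOuterMeasure.Build R _ mu
  lebesgue_outer_measure0 lebesgue_outer_measure_ge0
  lebesgue_outer_measure_subset lebesgue_outer_measure_sigma_subadditive.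

Lemma lebesgue_outer_measure_box_le a b : (mu (box a b) <= (box_volume a b)%:E)%E.
Proof.
pose ab k : 'rV[R]_n.+1 * 'rV[R]_n.+1 := if k is 0%N then (a, b) else (0, 0).
apply: (le_trans (lebesgue_outer_measure_le (ab := ab) _)).
  by move=> x xab; exists 0%N.
rewrite nneseries_recl//; last by move=> k _; rewrite lee_fin box_volume_ge0.
rewrite eseries_cond eseries0 ?adde0// => -[|k] //= _ _.
by rewrite box_volumexx.
Qed.

Definition shift (v : 'rV[R]_n.+1) A := [set x | A (x + v)].

Lemma shift_box v a b : shift v (box a b) = box (a - v) (b - v).
Proof.
by apply/seteqP; split => x xab i; have := xab i; rewrite !mxE ltrBlDr lerBrDr.
Qed.

Lemma box_volumeB v a b : box_volume (a - v) (b - v) = box_volume a b.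
Proof.
apply: eq_bigr => i _; rewrite !mxE; congr (Num.max _ _).
by rewrite opprB addrA subrK.
Qed.

Lemma shiftK v A : shift v (shift (- v) A) = A.
Proof. by apply/seteqP; split => x; rewrite /shift/= addrK. Qed.

Lemma lebesgue_outer_measure_shift v A : mu (shift v A) = mu A.
Proof.
suff shift_le w B : (mu (shift w B) <= mu B)%E.
  by apply/eqP; rewrite eq_le shift_le -{1}(shiftK (- v) A) opprK shift_le.
apply: le_ereal_inf_tmp => _ [ab Bab <-].
apply: (le_trans (lebesgue_outer_measure_le
  (ab := fun k => ((ab k).1 - w, (ab k).2 - w)) _)).
  move=> x /Bab[k _ xk]; exists k => //.
  by have -> : box ((ab k).1 - w) ((ab k).2 - w) x =
    shift w (box (ab k).1 (ab k).2) x by rewrite shift_box.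
by apply: lee_nneseries => [k _ _|k _];
  rewrite lee_fin ?box_volume_ge0//= box_volumeB.
Qed.

Lemma lebesgue_measurable_shift v A :
  lebesgue_measurable A -> lebesgue_measurable (shift v A).
Proof.
move=> mA X; rewrite -(lebesgue_outer_measure_shift (- v) X) (mA (shift (- v) X)).
rewrite -[in RHS](lebesgue_outer_measure_shift (- v) (X `&` _)).
rewrite -[in RHS](lebesgue_outer_measure_shift (- v) (X `&` ~` _)).
by congr (mu _ + mu _)%E; apply/seteqP; split => x; rewrite /shift/= subrK.
Qed.

Definition upd (l : 'I_n.+1) (t : R) a : 'rV[R]_n.+1 :=
  \row_i (if i == l then t else a 0 i).

Lemma box_volumeD1 l a b : box_volume a b =
  Num.max 0 (b 0 l - a 0 l) * \prod_(i | i != l) Num.max 0 (b 0 i - a 0 i).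
Proof. by rewrite /box_volume (bigD1 l). Qed.

(** The hyperplane cuts each box of a cover into two boxes whose volumes add up to at most the
    original volume. *)
Lemma lebesgue_measurable_halfspace l t :
  lebesgue_measurable [set x : 'rV[R]_n.+1 | x 0 l <= t].
Proof.
set H := mkset _; apply: le_caratheodory_measurable => X; apply: le_ereal_inf_tmp => _ [ab Xab <-].
(* [lo k] is the upper corner of the part of the box below the hyperplane, [hi k] the lower corner
   of the part above it. *)
pose lo k := upd l (Num.min ((ab k).2 0 l) t) (ab k).2.
pose hi k := upd l (Num.max ((ab k).1 0 l) t) (ab k).1.
have le1 : (mu (X `&` H) <=
    \sum_(0 <= k <oo) (box_volume (ab k).1 (lo k))%:E)%E.
  apply: (lebesgue_outer_measure_le (ab := fun k => ((ab k).1, lo k))) => x.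
  move=> [/Xab[k _ xk] /= xt]; exists k => // i; have /andP[xa xb] := xk i.
  by rewrite xa mxE; case: eqP => [il|_] //; rewrite le_min -il xb il.
have le2 : (mu (X `&` ~` H) <=
    \sum_(0 <= k <oo) (box_volume (hi k) (ab k).2)%:E)%E.
  apply: (lebesgue_outer_measure_le (ab := fun k => (hi k, (ab k).2))) => x.
  move=> [/Xab[k _ xk] /= /negP]; rewrite -ltNge => xt; exists k => // i.
  have /andP[xa xb] := xk i.
  by rewrite xb mxE andbT; case: eqP => [il|_] //; rewrite gt_max -il xa il.
apply: (le_trans (leeD le1 le2)); rewrite -nneseriesD; last 2 first.
- by move=> *; rewrite lee_fin box_volume_ge0.
- by move=> *; rewrite lee_fin box_volume_ge0.
apply: lee_nneseries => k _ *; first by rewrite -EFinD lee_fin addr_ge0 ?box_volume_ge0.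
set a := (ab k).1; set b := (ab k).2.
rewrite -EFinD lee_fin !(box_volumeD1 l) /lo /hi !mxE eqxx -/a -/b.
rewrite [X in _ * X + _](_ : _ = \prod_(i | i != l) Num.max 0 (b 0 i - a 0 i));
  last by apply: eq_bigr => i /negPf il; rewrite mxE il.
rewrite [X in _ + _ * X](_ : _ = \prod_(i | i != l) Num.max 0 (b 0 i - a 0 i));
  last by apply: eq_bigr => i /negPf il; rewrite mxE il.
rewrite -mulrDl ler_wpM2r//; first by apply: prodr_ge0 => i _; rewrite le_max lexx.
move: (a 0 l) (b 0 l) => {}a {}b.
rewrite /Num.min /Num.max; repeat case: ifPn; rewrite -?leNgt; lra.
Qed.

Lemma lebesgue_measurable_box a b : lebesgue_measurable (box a b).
Proof.
have mI (F : 'I_n.+1 -> set 'rV[R]_n.+1) : (forall i, lebesgue_measurable (F i)) ->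
    lebesgue_measurable [set x | forall i, F i x].
  move=> mF; rewrite (_ : mkset _ = \bigcap_(i in [set: 'I_n.+1]) F i).
    apply: (@fin_bigcap_measurable _
      (caratheodory_type (mu : {outer_measure set _ -> \bar R}))) => //.
    by move=> i _; exact: mF.
  by apply/seteqP; split => x Fx i; [move=> _; exact: Fx|exact: Fx].
apply: (mI (fun i => [set x : 'rV[R]_n.+1 | a 0 i < x 0 i <= b 0 i])) => i /=.
have -> : [set x : 'rV[R]_n.+1 | a 0 i < x 0 i <= b 0 i] =
    [set x | x 0 i <= b 0 i] `&` ~` [set x | x 0 i <= a 0 i].
  apply/seteqP; split => x /=.
    by move=> /andP[ax ->]; split => //; apply/negP; rewrite -ltNge.
  by move=> [-> /negP]; rewrite -ltNge => ->.
apply: caratheodory_measurable_setI; first exact: lebesgue_measurable_halfspace.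
by apply: caratheodory_measurable_setC; exact: lebesgue_measurable_halfspace.
Qed.

End outer_measure.

(** The least of finitely many thresholds serves all indices. Asking for [P i] on a whole interval
    [0 < e <= d] spares a separate monotonicity argument; the default 1 covers an empty index
    type. *)
Lemma uniform_pos (R : realType) (I : finType) (P : I -> R -> Prop) :
  (forall i, exists2 d, 0 < d & forall e, 0 < e <= d -> P i e) ->
  exists2 d, 0 < d & forall i e, 0 < e <= d -> P i e.
Proof.
move=> dP; have /choice[d {}dP] i : exists d, 0 < d /\ forall e, 0 < e <= d -> P i e.
  by have [d] := dP i; exists d.
exists (\big[Num.min/1]_i d i).
  by apply/bigmin_gtP; split => // i _; exact: (dP i).1.
move=> i e /andP[e0 ed]; apply: (dP i).2; rewrite e0 (le_trans ed)//.
exact: bigmin_le.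
Qed.

(** * Continuity of translation in measure *)

Section translation_continuity.
Context {R : realType} {n : nat}.
Implicit Types (a b u v : 'rV[R]_n.+1) (A B : set 'rV[R]_n.+1).
Local Notation mu := (@lebesgue_outer_measure R n.+1).

Lemma outer_measure_le_sum (I : eqType) (r : seq I) A (F : I -> set 'rV[R]_n.+1) :
  A `<=` [set x | exists2 i, i \in r & F i x] ->
  (mu A <= \sum_(i <- r) mu (F i))%E.
Proof.
elim: r A => [|i r IH] A AF.
  rewrite big_nil (_ : A = set0) ?lebesgue_outer_measure0//.
  by apply/seteqP; split => // x /AF[].
rewrite big_cons (le_trans _ (leeD2l _ (IH _ (@subset_refl _ _))))//.
apply: le_trans (outer_measureU2 _ _ _); apply: le_outer_measure => x /AF[j].
by rewrite inE => /predU1P[-> ?|? ?]; [left|right; exists j].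
Qed.

Lemma box_volume_updr l t a b : box_volume a (upd l t b) =
  Num.max 0 (t - a 0 l) * \prod_(i | i != l) Num.max 0 (b 0 i - a 0 i).
Proof.
rewrite (box_volumeD1 l) mxE eqxx; congr (_ * _).
by apply: eq_bigr => i /negPf il; rewrite mxE il.
Qed.

Lemma box_volume_updl l t a b : box_volume (upd l t a) b =
  Num.max 0 (b 0 l - t) * \prod_(i | i != l) Num.max 0 (b 0 i - a 0 i).
Proof.
rewrite (box_volumeD1 l) mxE eqxx; congr (_ * _).
by apply: eq_bigr => i /negPf il; rewrite mxE il.
Qed.

(** A point that leaves the box under a translation by less than d lies in a slab of thickness d
    along one of the faces; [Q l] is the volume of the faces orthogonal to axis l. *)
Lemma box_setD_shift a b (e : R) : 0 < e -> exists2 d : R, 0 < d &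
  forall u, (forall i, `|u 0 i| < d) ->
    (mu (box a b `\` shift u (box a b)) <= e%:E)%E.
Proof.
move=> e0; pose Q l := \prod_(i | i != l) Num.max 0 (b 0 i - a 0 i).
have Q0 l : 0 <= Q l by apply: prodr_ge0 => i _; rewrite le_max lexx.
have S0 : 0 < 1 + \sum_l Q l by rewrite ltr_pwDl// sumr_ge0.
(* Two slabs for each axis have total volume at most 2 d times the sum of the [Q l]; the summand 1
   keeps the denominator positive. *)
pose d := e / (1 + \sum_l Q l) / 2.
have d0 : 0 < d by rewrite !divr_gt0.
exists d => // u ud.
pose slab l := box a (upd l (a 0 l + d) b) `|` box (upd l (b 0 l - d) a) b.
apply: (@le_trans _ _ (\sum_(l <- index_enum 'I_n.+1) mu (slab l))%E).
  apply: outer_measure_le_sum => x [xab /existsNP[l xl]].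
  exists l; rewrite ?mem_index_enum//.
  have /andP[al bl] := xab l; move: (ud l) xl; rewrite ltr_norml mxE => /andP[u1 u2].
  move=> /negP; rewrite negb_and -leNgt -ltNge => /orP[xl|xl]; [left|right] => i;
    have /andP[ai bi] := xab i; rewrite mxE ?ai ?bi ?andbT/=;
    by case: eqP => [->|//]; lra.
apply: (@le_trans _ _ (\sum_l (2 * d * Q l)%:E)%E).
  apply: lee_sum => l _; apply: le_trans (outer_measureU2 _ _ _) _.
  apply: (le_trans (leeD (lebesgue_outer_measure_box_le _ _)
    (lebesgue_outer_measure_box_le _ _))).
  rewrite box_volume_updr box_volume_updl -/(Q l) -EFinD lee_fin -mulrDl.
  rewrite ler_wpM2r//.
  rewrite (_ : a 0 l + d - a 0 l = d); last by ring.
  rewrite (_ : b 0 l - (b 0 l - d) = d); last by ring.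
  by rewrite max_r ?(ltW d0)// mulr2n mulrDl mul1r.
rewrite sumEFin lee_fin -mulr_sumr /d.
rewrite -[X in _ <= X]mulr1 -[X in _ <= _ * X](@mulfV _ (1 + \sum_l Q l)) ?gt_eqF//.
have QS : \sum_l Q l <= 1 + \sum_l Q l by rewrite lerDr.
rewrite [X in X * _ <= _](_ : _ = e / (1 + \sum_l Q l)); last by field; rewrite gt_eqF.
by rewrite -mulrA [X in _ <= _ * X]mulrC ler_pM2l// ler_wpM2l// invr_ge0 ltW.
Qed.

(** The tail of a convergent series of volumes is small, so up to measure e the set is covered by
    finitely many boxes. *)
Lemma box_cover A (x : \bar R) (e : R) : (mu A < x)%E -> (x < +oo)%E -> 0 < e ->
  exists (ab : nat -> 'rV[R]_n.+1 * 'rV[R]_n.+1) (N : nat),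
    [/\ A `<=` \bigcup_k box (ab k).1 (ab k).2,
        (\sum_(0 <= k <oo) (box_volume (ab k).1 (ab k).2)%:E < x)%E &
        (mu (\bigcup_(k in ~` `I_N) box (ab k).1 (ab k).2) <= e%:E)%E].
Proof.
move=> Ax xoo e0; have [ab [Aab abx]] := expansion_of_cover Ax.
pose vol k := (box_volume (ab k).1 (ab k).2)%:E.
have vol0 k : (0 <= vol k)%E by rewrite lee_fin box_volume_ge0.
have [N tailN] : exists N, (\sum_(N <= k <oo) vol k <= e%:E)%E.
  have := nneseries_tail_cvg (lt_trans abx xoo) (fun k _ => vol0 k).
  move=> /fine_cvgP[finv /cvgr_lt/(_ e e0)] tl.
  have [N _ /(_ N)] := filterI finv tl.
  rewrite /= leqnn => /(_ isT)[Nfin Ne]; exists N.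
  by rewrite -(fineK Nfin) lee_fin ltW.
exists ab, N; split => //; apply: le_trans tailN.
apply: (le_trans (outer_measure_sigma_subadditive_tail _ _ _)).
apply: lee_nneseries => [k _ _|k _]; first exact: lebesgue_outer_measure_ge0.
exact: lebesgue_outer_measure_box_le.
Qed.

Lemma outer_measure_setD_shift A (e : R) :
  lebesgue_measurable A -> (mu A < +oo)%E -> 0 < e ->
  exists2 d : R, 0 < d & forall u, (forall i, `|u 0 i| < d) ->
    (mu (A `\` shift u A) <= e%:E)%E.
Proof.
move=> mA Aoo e0; pose e3 := e / 3; have e30 : 0 < e3 by rewrite divr_gt0.
have Afin : mu A \is a fin_num by rewrite ge0_fin_numE// lebesgue_outer_measure_ge0.
have lt1 : (mu A < mu A + e3%:E)%E by rewrite lteDl.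
have lt2 : (mu A + e3%:E < +oo)%E by rewrite -(fineK Afin) -EFinD ltey.
have [ab [N [Aab abA tailN]]] := box_cover lt1 lt2 e30.
pose bx k := box (ab k).1 (ab k).2; pose V := \bigcup_k bx k.
have V_A : (mu (V `&` ~` A) <= e3%:E)%E.
  have := mA V; rewrite (_ : V `&` A = A); last exact/setIidPr.
  move=> muV; have : (mu V <= mu A + e3%:E)%E.
    apply: le_trans (ltW abA).
    apply: (le_trans (outer_measure_sigma_subadditive _ _)).
    apply: lee_nneseries => [k _ _|k _]; first exact: lebesgue_outer_measure_ge0.
    exact: lebesgue_outer_measure_box_le.
  by rewrite muV leeD2lE.
have e4 : 0 < e3 / N.+1%:R by rewrite divr_gt0.
have [d d0 dP] := uniform_pos (I := 'I_N)
  (P := fun k d => forall u, (forall i, `|u 0 i| < d) ->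
    (mu (bx k `\` shift u (bx k)) <= (e3 / N.+1%:R)%:E)%E)
  (fun k => let: ex_intro2 d d0 dP := box_setD_shift (ab k).1 (ab k).2 e4 in
     ex_intro2 _ _ d d0 (fun f fd u uf => dP u (fun i => lt_le_trans (uf i)
       (proj2 (andP fd))))).
exists d => // u ud.
pose T0 := \bigcup_(k in ~` `I_N) bx k.
(* A point x of A with x + u outside A lies in the tail of the cover, or x + u lies in the excess of
   the cover over A, or x leaves one of the first N boxes. *)
apply: (@le_trans _ _ (mu T0 + mu (shift u (V `&` ~` A)) +
    \sum_(k <- index_enum 'I_N) mu (bx k `\` shift u (bx k)))%E).
  apply: le_trans (leeD2r _ (outer_measureU2 _ _ _)).
  apply: le_trans (leeD2l _ (outer_measure_le_sum (@subset_refl _ _))).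
  apply: le_trans (outer_measureU2 _ _ _).
  apply: le_outer_measure => x [Ax nAx].
  have [k _ xk] := Aab _ Ax.
  have [kN|Nk] := ltnP k N; last first.
    by left; left; exists k => //=; apply/negP; rewrite -leqNgt.
  have [xuk|xuk] := pselect (bx k (x + u)).
    by left; right; split => //; exists k.
  by right; exists (Ordinal kN); rewrite ?mem_index_enum.
rewrite lebesgue_outer_measure_shift.
have -> : e = e3 + e3 + e3 by rewrite /e3; field.
rewrite !EFinD; apply: leeD; first exact: leeD.
apply: (@le_trans _ _ (\sum_(k < N) (e3 / N.+1%:R)%:E)%E).
  by apply: lee_sum => k _; apply: (dP k d) => //; rewrite d0 lexx.
rewrite sumEFin lee_fin sumr_const card_ord -[X in X <= _]mulr_natr.
rewrite -mulrA ger_pMr// mulrC ler_pdivrMr ?mul1r ?ler_nat//.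
Qed.

End translation_continuity.

(** * Averages of a set over separated translations *)

Section counting.
Context {R : realType} {n : nat}.
Implicit Types (a b u v : 'rV[R]_n.+1) (A B D G : set 'rV[R]_n.+1).
Local Notation mu := (@lebesgue_outer_measure R n.+1).

Definition separated (I : finType) (s : R) (v : I -> 'rV[R]_n.+1) :=
  forall i j, i != j -> exists l, s <= `|v i 0 l - v j 0 l|.

(** A grid of mesh s has at most one of the points in each cell. An axis of length at least s
    carries at most length / s + 1 cells, which is at most 2 length / s. *)
Lemma card_separated_box (I : finType) (v : I -> 'rV[R]_n.+1) (s : R) a b :
  0 < s -> separated s v -> (forall l, s <= b 0 l - a 0 l) ->
  #|[pred i | `[< box a b (v i) >]]|%:R <= (2 / s) ^+ n.+1 * box_volume a b.
Proof.
move=> s0 sv sab; set A := [pred i | `[< box a b (v i) >]].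
pose M l := (Num.truncn ((b 0 l - a 0 l) / s)).+1.
pose q i l := (v i 0 l - a 0 l) / s.
pose code i : {dffun forall l, 'I_(M l)} := [ffun l => inord (Num.truncn (q i l))].
have q0 i l : i \in A -> 0 <= q i l.
  by move=> /asboolP iA; have /andP[al _] := iA l; rewrite divr_ge0 ?(ltW s0)// subr_ge0 ltW.
have qM i l : i \in A -> (Num.truncn (q i l) < M l)%N.
  move=> /asboolP iA; have /andP[_ bl] := iA l; rewrite ltnS; apply: le_truncn.
  by rewrite ler_wpM2r ?invr_ge0 ?(ltW s0)// lerD2r.
have code_inj : {in A &, injective code}.
  move=> i j iA jA /ffunP codeij; apply/eqP/negPn/negP => /sv[l].
  apply/negP; rewrite -ltNge; have := codeij l; rewrite !ffunE.
  move=> /(congr1 val) /=; rewrite !inordK; [|exact: qM..] => qij.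
  have /andP[i1 i2] := truncn_itv (q0 i l iA).
  have /andP[j1 j2] := truncn_itv (q0 j l jA).
  rewrite qij in i1 i2; move: j1 j2 i1 i2; set k := Num.truncn _.
  rewrite -natr1 /q !ler_pdivlMr// !ltr_pdivrMr// => j1 j2 i1 i2.
  by rewrite ltr_norml; apply/andP; split; lra.
have : (#|A| <= \prod_l M l)%N.
  rewrite -(card_in_imset code_inj); apply: (leq_trans (max_card _)).
  rewrite card_dep_ffun foldrE big_image/=.
  by rewrite (eq_bigr M)// => l _; rewrite card_ord.
rewrite -(ler_nat R) => /le_trans; apply.
rewrite natr_prod (_ : _ ^+ n.+1 = \prod_(l < n.+1) (2 / s)); last first.
  by rewrite prodr_const card_ord.
rewrite -big_split/=.
apply: ler_prod => l _; rewrite ler0n/=.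
have sl := sab l; have bal : 0 <= b 0 l - a 0 l by rewrite (le_trans (ltW s0)).
rewrite max_r// /M -natr1.
rewrite (_ : 2 / s * _ = (b 0 l - a 0 l) / s + (b 0 l - a 0 l) / s); last by ring.
rewrite lerD ?truncn_le ?divr_ge0 ?(ltW s0)//.
by rewrite ler_pdivlMr ?mul1r.
Qed.

(** Integration over G of the number of sets [F i] that contain a point, with respect to the
    Caratheodory measure. *)
Lemma sum_outer_measure_le (I : finType) (F : I -> set 'rV[R]_n.+1) G (M : R) :
  lebesgue_measurable G -> (forall i, lebesgue_measurable (F i)) ->
  (forall x, G x -> #|[pred i | `[< F i x >]]|%:R <= M) ->
  (\sum_i mu (F i `&` G) <= M%:E * mu G)%E.
Proof.
move=> mG mF FM.
pose m := (mu : {outer_measure set _ -> \bar R}).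
pose T := caratheodory_type m; pose nu := (m : {measure set T -> \bar R}).
have mG' : measurable (G : set T) by [].
have mF' i : measurable (F i : set T) by exact: mF.
have -> : (\sum_i mu (F i `&` G) =
    \int[nu]_(x in (G : set T)) \sum_i (\1_(F i : set T) x)%:E)%E.
  rewrite ge0_integral_sum//; last first.
    by move=> i; apply/measurable_EFinP; exact: measurable_indic.
  by apply: eq_bigr => i _; rewrite integral_indic.
rewrite -(integral_cst nu mG'); apply: ge0_le_integral => //.
- by move=> x _; apply: sume_ge0 => i _; rewrite lee_fin.
- apply: emeasurable_sum => i; apply/measurable_EFinP; exact: measurable_indic.
- move=> x Gx; rewrite sumEFin lee_fin; apply: le_trans (FM x Gx).
  rewrite -sum1_card natr_sum [in leRHS]big_mkcond/=; apply: ler_sum => i _.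
  rewrite indicE unfold_in/=; case: asboolP => Fx; last by rewrite memNset.
  by rewrite mem_set.
Qed.

End counting.

(** * Spreading a set of small measure by many translations *)

Section smear.
Context {R : realType} {n : nat}.
Implicit Types (a b u v x : 'rV[R]_n.+1) (A B D G : set 'rV[R]_n.+1).
Local Notation mu := (@lebesgue_outer_measure R n.+1).

Lemma card_separated_box_large (K : seq nat) (ab : nat -> 'rV[R]_n.+1 * 'rV[R]_n.+1)
    (c : R) : 0 < c -> exists N0, forall N (I : finType) (v : I -> 'rV[R]_n.+1) k,
  (N0 <= N)%N -> k \in K -> separated (c / N%:R) v ->
  #|[pred i | `[< box (ab k).1 (ab k).2 (v i) >]]|%:R <=
    N%:R ^+ n.+1 * (2 / c) ^+ n.+1 * box_volume (ab k).1 (ab k).2.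
Proof.
move=> c0; pose M k l := (Num.truncn (c / ((ab k).2 0 l - (ab k).1 0 l))).+1.
(* Beyond [M k l] the mesh c / N is below the side l of the box k; the sum bounds all these
   thresholds at once. A box with a nonpositive side is empty and counts no point. *)
exists (\sum_(k <- K) \sum_l M k l).+1 => N I v k N0N kK sv.
have N0 : 0 < N%:R :> R by rewrite ltr0n (leq_trans _ N0N).
have [/existsP[l bal]|/existsPn abl] :=
    boolP [exists l, (ab k).2 0 l <= (ab k).1 0 l].
  rewrite (@eq_card0 _ [pred i | _]); last first.
    move=> i; apply/negbTE/negP; rewrite inE => xk; have /andP[al bl] := xk l.
    by have := lt_le_trans al (le_trans bl bal); rewrite ltxx.
  by rewrite !mulr_ge0 ?exprn_ge0 ?box_volume_ge0 ?ltW ?divr_gt0.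
have cN : 0 < c / N%:R by rewrite divr_gt0.
apply: (le_trans (card_separated_box cN sv _)).
  move=> l; have := abl l; rewrite -ltNge -subr_gt0 => bal.
  rewrite ler_pdivrMr// mulrC -ler_pdivrMr//.
  apply: (le_trans (ltW (truncnS_gt _))); rewrite ler_nat; apply: leq_trans N0N.
  rewrite -/(M k l) (big_rem k)//= (bigD1 l)//=.
  by rewrite -!addnA -addnS leq_addr.
rewrite ler_wpM2r ?box_volume_ge0// -exprMn.
by rewrite (_ : 2 / (c / N%:R) = N%:R * (2 / c))//; field; rewrite !gt_eqF.
Qed.

(** Finitely many boxes of total volume below m cover D up to measure e, and each point of G falls
    into few translates of each box. The gain is the factor [mu G]: on average a translate of D
    meets only a small fraction of G, however small G is. *)
Lemma smear G D (c m e : R) : lebesgue_measurable G -> (mu G < +oo)%E ->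
  0 < c -> 0 < e -> (mu D < m%:E)%E ->
  exists N0, forall N (I : finType) (v : I -> 'rV[R]_n.+1),
    (N0 <= N)%N -> #|I| = (N ^ n.+1)%N -> separated (c / N%:R) v ->
    (\sum_i mu (shift (v i) D `&` G) <=
      (N%:R ^+ n.+1)%:E * (((2 / c) ^+ n.+1 * m)%:E * mu G + e%:E))%E.
Proof.
move=> mG Goo c0 e0 Dm; have [ab [K [Dab abm tail]]] := box_cover Dm (ltey _) e0.
have [N0 N0P] := card_separated_box_large (iota 0 K) ab c0.
exists N0 => N I v N0N cardI sv.
pose bx k := box (ab k).1 (ab k).2; pose vol k := box_volume (ab k).1 (ab k).2.
pose T := \bigcup_(k in ~` `I_K) bx k.
pose C := N%:R ^+ n.+1 * (2 / c) ^+ n.+1.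
have C0 : 0 <= C by rewrite mulr_ge0// exprn_ge0// ltW// divr_gt0.
have bxP k : (k < K)%N ->
    (\sum_i mu (shift (v i) (bx k) `&` G) <= (C * vol k)%:E * mu G)%E.
  move=> kK; apply: sum_outer_measure_le => //.
    by move=> i; apply/lebesgue_measurable_shift/lebesgue_measurable_box.
  move=> x _; apply: (N0P N I (fun i => x + v i)) => //.
    by rewrite mem_iota.
  move=> i j /sv[l ijl]; exists l; rewrite !mxE.
  by rewrite opprD addrACA subrr add0r.
have shiftP i : (mu (shift (v i) D `&` G) <=
    \sum_(k < K) mu (shift (v i) (bx k) `&` G) + mu (shift (v i) T))%E.
  apply: le_trans (leeD2r _ (outer_measure_le_sum (@subset_refl _ _))).
  apply: le_trans (outer_measureU2 _ _ _); apply: le_outer_measure => x [xD xG].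
  have [k _ xk] := Dab _ xD; have [kK|Kk] := ltnP k K.
    by left; exists (Ordinal kK); rewrite ?mem_index_enum.
  by right; exists k => //=; apply/negP; rewrite -leqNgt.
apply: (le_trans (lee_sum _ (fun i _ => shiftP i))).
rewrite big_split/= exchange_big/=.
apply: (@le_trans _ _ (\sum_(k < K) (C * vol k)%:E * mu G + \sum_(i : I) e%:E)%E).
  apply: leeD; first by apply: lee_sum => k _; exact: bxP.
  by apply: lee_sum => i _; rewrite lebesgue_outer_measure_shift.
have -> : mu G = (fine (mu G))%:E.
  by rewrite fineK// ge0_fin_numE// lebesgue_outer_measure_ge0.
set g := fine _; have g0 : 0 <= g by rewrite fine_ge0// lebesgue_outer_measure_ge0.
under eq_bigr do rewrite -EFinM.
rewrite !sumEFin -?EFinM -?EFinD -?EFinM -?EFinD lee_fin sumr_const cardI mulrDr.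
apply: lerD; last by rewrite -[X in X <= _]mulr_natl natrX.
have volm : \sum_(k < K) vol k <= m.
  rewrite -lee_fin -sumEFin; apply: le_trans (ltW abm).
  rewrite -(big_mkord xpredT (fun k => (vol k)%:E)); apply: nneseries_lim_ge => k _.
  by rewrite lee_fin box_volume_ge0.
rewrite -mulr_suml -mulr_sumr mulrA; apply: ler_wpM2r => //.
by rewrite mulrA; exact: ler_wpM2l.
Qed.

Definition window (L : R) : set 'rV[R]_n.+1 := box (const_mx (- L)) (const_mx L).

Lemma windowP L x : (forall i, `|x 0 i| < L) -> window L x.
Proof. by move=> xL i; have := xL i; rewrite !mxE ltr_norml => /andP[-> /ltW]. Qed.

Lemma window_norm L x i : window L x -> `|x 0 i| <= L.
Proof. by move=> /(_ i); rewrite !mxE ler_norml => /andP[/ltW-> ->]. Qed.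

Lemma lebesgue_measurable_window L : lebesgue_measurable (window L).
Proof. exact: lebesgue_measurable_box. Qed.

Lemma outer_measure_window_lty L : (mu (window L) < +oo)%E.
Proof. exact: le_lt_trans (lebesgue_outer_measure_box_le _ _) (ltey _). Qed.

(** A cover of small total volume would have a finite subcover of a cube by slightly larger open
    boxes, and these would contain too few points of a fine grid. *)
Lemma outer_measure_window_gt0 : (0 < mu (window 1))%E.
Proof.
rewrite ltNge; apply/negP => W0.
(* Each axis costs a factor 8: 2 for doubling the boxes and 4 = 2 / 2^-1 from the count of grid
   points of mesh 2^-1 / N. With [eta] fewer than half of the grid points are reached. *)
pose eta : R := 2^-1 / (8 ^+ n.+1).
have eta0 : 0 < eta by rewrite divr_gt0// ?exprn_gt0// invr_gt0.
have Weta : (mu (window 1) < eta%:E)%E by apply: (le_lt_trans W0); rewrite lte_fin.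
have [ab [Wab abeta]] := expansion_of_cover Weta.
(* Compactness needs open sets: the sides are doubled with the lower corner fixed, which takes in
   the closed upper faces of the half-open box. *)
pose O k := [set x : 'rV[R]_n.+1 |
  forall l, (ab k).1 0 l < x 0 l < 2 * (ab k).2 0 l - (ab k).1 0 l].
have openO k : open (O k).
  rewrite openE => x xO.
  have [l|e e0 eP] := uniform_pos (P := fun l e => forall t, `|x 0 l - t| < e ->
    (ab k).1 0 l < t < 2 * (ab k).2 0 l - (ab k).1 0 l).
    have /andP[x1 x2] := xO l.
    exists (Num.min (x 0 l - (ab k).1 0 l) (2 * (ab k).2 0 l - (ab k).1 0 l - x 0 l)).
      by rewrite lt_min !subr_gt0 x1.
    move=> e /andP[_]; rewrite le_min => /andP[e1 e2] t; rewrite ltr_norml => /andP[t1 t2].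
    by apply/andP; split; lra.
  apply/nbhs_ballP; exists e => // y [_ xy] l.
  by apply: (eP l e); [rewrite e0 lexx|exact: xy].
pose Q := [set x : 'rV[R]_n.+1 | forall l, `[0, 2^-1]%classic (x 0 l)].
have : compact Q.
  have := @rV_compact R n.+1 (fun=> `[0, 2^-1]%classic).
  apply.
  by move=> _; exact: segment_compact.
rewrite compact_cover => /(_ nat [set: nat] O)[//||K _ QK].
  move=> x xQ; have /Wab[k _ xk] : window 1 x.
    apply: windowP => i; have := xQ i; rewrite /= in_itv/= => /andP[x0 x1].
    by rewrite ger0_norm// (le_lt_trans x1)// invf_lt1 ?ltr1n.
  exists k => // l; have /andP[x1 x2] := xk l; rewrite x1/= (le_lt_trans x2)//; lra.
pose cd k : 'rV[R]_n.+1 * 'rV[R]_n.+1 := ((ab k).1, 2 *: (ab k).2 - (ab k).1).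
have c0 : 0 < 2^-1 :> R by rewrite invr_gt0.
have [N0 N0P] := card_separated_box_large (finmap.enum_fset K) cd c0.
pose N := N0.+1; pose v (f : {ffun 'I_n.+1 -> 'I_N}) : 'rV[R]_n.+1 :=
  \row_l ((f l)%:R * (2^-1 / N%:R)).
have vs : separated (2^-1 / N%:R) v.
  move=> f g /eqP fg; have [l fgl] : exists l, f l != g l.
    by apply/existsP; rewrite -negb_forall; apply/negP => /forallP e; apply: fg;
      apply/ffunP => l; apply/eqP.
  have h0 : 0 < 2^-1 / N%:R :> R by rewrite divr_gt0.
  exists l; rewrite !mxE -mulrBl normrM (gtr0_norm h0) ler_peMl ?(ltW h0)//.
  have [fg'|fg'|/val_inj fg'] := ltngtP (f l) (g l); last by rewrite fg' eqxx in fgl.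
  - rewrite distrC ger0_norm -?natrB ?ler0n// 1?ltnW//.
    by rewrite ler1n subn_gt0.
  - rewrite -natrB 1?ltnW// ger0_norm ?ler0n//.
    by rewrite ler1n subn_gt0.
have vQ f : Q (v f).
  move=> l; rewrite /= in_itv/= mxE mulr_ge0 ?divr_ge0//=.
  rewrite mulrCA ler_piMr// ler_pdivrMr ?ltr0n// mul1r ler_nat.
  exact: ltnW.
have vcd f : exists2 k, k \in finmap.enum_fset K & box (cd k).1 (cd k).2 (v f).
  have [k kK vk] := QK _ (vQ f); exists k => // l.
  by have := vk l; rewrite !mxE => /andP[-> /ltW->].
have vol_cd k : box_volume (cd k).1 (cd k).2 =
    2 ^+ n.+1 * box_volume (ab k).1 (ab k).2.
  rewrite (_ : 2 ^+ n.+1 = \prod_(l < n.+1) (2 : R)); last first.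
    by rewrite prodr_const card_ord.
  rewrite -big_split/=; apply: eq_bigr => l _; rewrite !mxE maxr_pMr// mulr0.
  by congr (Num.max _ _); ring.
have volK : \sum_(k <- finmap.enum_fset K) box_volume (ab k).1 (ab k).2 < eta.
  rewrite -lte_fin -sumEFin; apply: le_lt_trans abeta.
  by apply: lee_sum_fset_lim => k _; rewrite lee_fin box_volume_ge0.
have : N%:R ^+ n.+1 <= N%:R ^+ n.+1 * 8 ^+ n.+1 *
    \sum_(k <- finmap.enum_fset K) box_volume (ab k).1 (ab k).2 :> R.
  rewrite -natrX -[in X in X <= _](card_ord N) -[in X in X <= _](card_ord n.+1).
  rewrite -card_ffun.
  apply: (@le_trans _ _ (\sum_(k <- finmap.enum_fset K)
    #|[pred f | `[< box (cd k).1 (cd k).2 (v f) >]]|%:R)).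
    rewrite -natr_sum ler_nat -sum1_card.
    under [leqRHS]eq_bigr do rewrite -sum1_card big_mkcond.
    rewrite exchange_big/=; apply: leq_sum => f _.
    have [k kK vk] := vcd f; rewrite (big_rem k)//=.
    by rewrite unfold_in /= asboolT.
  rewrite mulr_sumr big_seq [leRHS]big_seq; apply: ler_sum => k kK.
  apply: (le_trans (N0P N _ v k _ kK vs)) => //.
  rewrite vol_cd mulrA -[_ * _ * 2 ^+ _]mulrA -exprMn.
  by rewrite natrX (_ : 2 / 2^-1 * 2 = 8 :> R)// invrK; ring.
rewrite leNgt => /negP; apply; rewrite -mulrA gtr_pMr ?exprn_gt0 ?ltr0n//.
apply: (@lt_trans _ _ (8 ^+ n.+1 * eta)); first by rewrite ltr_pM2l ?exprn_gt0.
by rewrite /eta mulrCA divff ?gt_eqF ?exprn_gt0// mulr1 invf_lt1 ?ltr1n.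
Qed.

End smear.

(** * Colour changes under small translations *)

Section measurable_colouring.
Context {R : realType} {n m : nat} (c : 'rV[R]_n.+1 -> 'I_m).
Hypothesis measurable_c : forall i, lebesgue_measurable [set x | c x = i].
Implicit Types (u v x : 'rV[R]_n.+1).
Local Notation mu := (@lebesgue_outer_measure R n.+1).

Definition flip u : set 'rV[R]_n.+1 := [set x | c x <> c (x + u)].

Lemma lebesgue_measurable_flip u : lebesgue_measurable (flip u).
Proof.
have -> : flip u = ~` \bigcup_(i in [set: 'I_m])
    ([set x | c x = i] `&` shift u [set x | c x = i]).
  apply/seteqP; split => x /=.
    by move=> cu [i _ [/= ci]]; rewrite /shift/= => cui; apply: cu; rewrite ci.
  by move=> nx cu; apply: nx; exists (c x) => //; split => //; rewrite /shift/=.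
apply: caratheodory_measurable_setC.
apply: (@fin_bigcup_measurable _
  (caratheodory_type (mu : {outer_measure set _ -> \bar R}))) => // i _.
apply: measurableI; first exact: measurable_c.
exact: (@lebesgue_measurable_shift R n).
Qed.

Lemma outer_measure_flip_small (L e : R) : 0 < e -> exists2 d : R, 0 < d &
  forall u, (forall l, `|u 0 l| < d) -> (mu (flip u `&` window L) <= e%:E)%E.
Proof.
move=> e0; have em : 0 < e / m.+1%:R by rewrite divr_gt0.
pose A i := [set x | c x = i] `&` window L.
have mA i : lebesgue_measurable (A i).
  apply: caratheodory_measurable_setI; first exact: measurable_c.
  exact: lebesgue_measurable_window.
have Aoo i : (mu (A i) < +oo)%E.
  apply: le_lt_trans (outer_measure_window_lty L).
  by apply: lebesgue_outer_measure_subset => x [].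
have [i|d d0 dP] := uniform_pos (I := 'I_m) (P := fun i d =>
    forall u, (forall l, `|u 0 l| < d) ->
      (mu (A i `\` shift u (A i)) <= (e / m.+1%:R)%:E)%E).
  have [d d0 dP] := outer_measure_setD_shift (mA i) (Aoo i) em.
  by exists d => // f /andP[_ fd] u uf; apply: dP => l; apply: lt_le_trans fd.
exists d => // u ud.
apply: (@le_trans _ _ (\sum_(i <- index_enum 'I_m) mu (A i `\` shift u (A i)))%E).
  apply: outer_measure_le_sum => x [xu xL]; exists (c x); first exact: mem_index_enum.
  by split => // -[cu _]; apply: xu; exact: esym cu.
apply: (@le_trans _ _ (\sum_(i < m) (e / m.+1%:R)%:E)%E).
  by apply: lee_sum => i _; apply: (dP i d) => //; rewrite d0 lexx.
rewrite sumEFin lee_fin sumr_const card_ord -[X in X <= _]mulr_natr.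
by rewrite -mulrA ger_pMr// mulrC ler_pdivrMr// mul1r ler_nat.
Qed.

Lemma norm_le_sum u l : `|u 0 l| <= \sum_i `|u 0 i|.
Proof. by rewrite (bigD1 l)//= lerDl sumr_ge0. Qed.

Lemma windowD L1 L2 x u : window L1 x -> (forall l, `|u 0 l| < L2) ->
  window (L1 + L2) (x + u).
Proof.
move=> xL uL; apply: windowP => l; rewrite mxE (le_lt_trans (ler_normD _ _))//.
by rewrite ler_ltD// window_norm.
Qed.

Lemma outer_measure_bigcup0 (F : nat -> set 'rV[R]_n.+1) :
  (forall k, mu (F k) = 0%E) -> mu (\bigcup_k F k) = 0%E.
Proof.
move=> F0; apply/eqP; rewrite eq_le lebesgue_outer_measure_ge0 andbT.
apply: (le_trans (outer_measure_sigma_subadditive _ _)).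
by rewrite eseries0 // => k _ _; exact: F0.
Qed.

(** If [c x = c (x + v)] but [c x <> c (x + u)], then x + v lies in [flip (u - v)], whose measure in
    a window tends to 0 as u approaches v. *)
Lemma outer_measure_unflip0 v :
  (forall d : R, 0 < d -> exists2 u, (forall l, `|(u - v) 0 l| < d) &
     forall x, c x <> c (x + u)) ->
  mu (~` flip v) = 0%E.
Proof.
move=> near_v; pose V := 1 + \sum_i `|v 0 i|.
have vV l : `|v 0 l| < V by rewrite ltr_pwDl// norm_le_sum.
have -> : ~` flip v = \bigcup_k (~` flip v `&` window k%:R).
  apply/seteqP; split => [x xv|x [k _ []]//].
  exists (Num.truncn (\sum_i `|x 0 i|)).+1 => //; split => //.
  apply: windowP => i; apply: le_lt_trans (norm_le_sum x i) _.
  exact: truncnS_gt.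
apply: outer_measure_bigcup0 => k.
apply/eqP; rewrite eq_le lebesgue_outer_measure_ge0 andbT.
apply/lee_addgt0Pr => e e0; rewrite add0e.
have [d d0 dP] := outer_measure_flip_small (k%:R + V) e0.
have [u uv cu] := near_v d d0.
apply: le_trans (dP _ uv); rewrite -[leRHS](lebesgue_outer_measure_shift v).
apply: lebesgue_outer_measure_subset => x [/= /contrapT xv xk]; split.
  by rewrite /flip/= addrACA subrr addr0 -xv.
exact: windowD.
Qed.

(** Going from x to x + v in k + 1 equal steps, the colour must change at one of them for almost
    every x. The window is wide enough to contain all intermediate points that start in
    [window 1]. *)
Lemma outer_measure_flip_gt0 v (k : nat) : mu (~` flip v) = 0%E ->
  (0 < mu (flip (k.+1%:R^-1 *: v) `&` window (1 + (1 + \sum_i `|v 0%R i|)%R)%R))%E.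
Proof.
set V := (1 + \sum_i `|v 0 i|)%R; set u := _ *: v => v0.
rewrite ltNge; apply/negP => flip0.
have : (0 < mu (window 1))%E by exact: outer_measure_window_gt0.
apply/negP; rewrite -leNgt.
pose F (j : 'I_k.+1) := shift (j%:R *: u) (flip u `&` window (1 + V)).
have jV (j : 'I_k.+1) l : `|(j%:R *: u) 0 l| < V.
  rewrite /u scalerA mxE normrM.
  apply: (@le_lt_trans _ _ `|v 0 l|); last by rewrite ltr_pwDl// norm_le_sum.
  rewrite ler_piMl// ger0_norm ?divr_ge0// ler_pdivrMr// mul1r ler_nat.
  exact/ltnW.
apply: (@le_trans _ _ (mu (~` flip v) +
    \sum_(j <- index_enum 'I_k.+1) mu (F j))%E).
  apply: le_trans (leeD2l _ (outer_measure_le_sum (@subset_refl _ _))).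
  apply: le_trans (outer_measureU2 _ _ _); apply: lebesgue_outer_measure_subset.
  move=> x x1; have [xv|xv] := pselect (flip v x); last by left.
  right; have [j xj] : exists j : 'I_k.+1, flip u (x + j%:R *: u).
    apply: contrapT => /forallNP nj; apply: xv.
    have cj j : (j <= k.+1)%N -> c (x + j%:R *: u) = c x.
      elim: j => [|j IH jk]; first by rewrite scale0r addr0.
      have /contrapT := nj (Ordinal jk); rewrite /= IH 1?ltnW// => ->.
      by rewrite -natr1 scalerDl scale1r addrA.
    by rewrite -(cj k.+1)// /u scalerA divff ?scale1r// pnatr_eq0.
  exists j; rewrite ?mem_index_enum//; split => //.
  exact: windowD.
rewrite v0 add0e big1// => j _; rewrite lebesgue_outer_measure_shift.
by apply/eqP; rewrite eq_le flip0 lebesgue_outer_measure_ge0.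
Qed.

End measurable_colouring.

(** * Centres with a moved configuration that avoids [flip c u] *)

Section good_centre.
Context {R : realType} {n m : nat} (c : 'rV[R]_n.+1 -> 'I_m).
Hypothesis measurable_c : forall i, lebesgue_measurable [set x | c x = i].
Local Notation mu := (@lebesgue_outer_measure R n.+1).
Context (J : finType) (j0 : J).
(** [gam l t j] stands for the vector j of the configuration, moved by the isometry with parameter t
    of the family l. *)
Context (gam : 'I_n.+1 -> R -> J -> 'rV[R]_n.+1) (cst : R).
Hypothesis gam1 : forall l t j i, 0 <= t <= 1 -> `|gam l t j 0 i| <= 1.
Hypothesis cst0 : 0 < cst.
Hypothesis gam_sep : forall N (a : {ffun 'I_n.+1 -> J}), (0 < N)%N ->
  separated (cst / N%:R) (fun i : {ffun 'I_n.+1 -> 'I_N} =>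
    \sum_l gam l ((i l)%:R / N%:R) (a l)).

Definition good u N : set 'rV[R]_n.+1 := [set x | flip c u x /\
  exists l (i : 'I_N), forall j, ~ flip c u (x + gam l (i%:R / N%:R) j)].

Let walk N (i : {ffun 'I_n.+1 -> 'I_N}) (a : {ffun 'I_n.+1 -> J}) (t : nat) :=
  \sum_(l < n.+1 | (l < t)%N) gam l ((i l)%:R / N%:R) (a l).

Lemma walkS N (i : {ffun 'I_n.+1 -> 'I_N}) (a : {ffun 'I_n.+1 -> J}) (l : 'I_n.+1) j :
  walk i [ffun l' => if l' == l then j else a l'] l.+1 =
  walk i a l + gam l ((i l)%:R / N%:R) j.
Proof.
rewrite /walk (bigD1 l)//= ffunE eqxx addrC; congr (_ + _).
apply: eq_big => l' /=; first by rewrite ltnS ltn_neqAle andbC.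
by move=> /andP[_ /negPf ll']; rewrite ffunE ll'.
Qed.

(** The copy used at each step is fixed in advance by [i]. As the current point flips without being
    good, this copy meets [flip c u], and a vector that does so is recorded in [a] as the next
    step. *)
Lemma walk_good u N (i : {ffun 'I_n.+1 -> 'I_N}) (L : R) x :
  flip c u x -> window L x ->
  (forall a (t : 'I_n.+1), ~ good u N (x + walk i a t)) ->
  exists a, (flip c u `&` window (L + 2 * n.+1%:R)) (x + walk i a n.+1).
Proof.
move=> xu xL nogood.
suff H t : (t <= n.+1)%N -> exists a, (flip c u `&` window (L + 2 * t%:R)) (x + walk i a t).
  exact: H.
elim: t => [_|t IH tn].
  exists [ffun=> j0]; rewrite /walk big_pred0//.
  by rewrite addr0 mulr0 addr0.
have [a [au aL]] := IH (ltnW tn); pose l := Ordinal tn.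
have := nogood a l; rewrite /good/= => ng.
have [j jP] : exists j, flip c u (x + walk i a t + gam l ((i l)%:R / N%:R) j).
  by apply: contrapT => /forallNP nj; apply: ng; split => //; exists l, (i l).
exists [ffun l' => if l' == l then j else a l'].
rewrite (walkS i a l j) addrA; split => //.
rewrite -[t.+1%:R]natr1 mulrDr mulr1 addrA; apply: windowD => // l'.
apply: le_lt_trans (gam1 _ _ _ _) _; last by rewrite ltr1n.
by rewrite divr_ge0//= ler_pdivrMr ?mul1r ?ler_nat ?(ltnW (ltn_ord _))// ltr0n (leq_ltn_trans _ (ltn_ord (i l))).
Qed.

Lemma good_centre v : mu (~` flip c v) = 0%E ->
  exists u N, (0 < N)%N /\ mu (good u N) <> 0%E.
Proof.
move=> v0; pose L := 1 + (1 + \sum_i `|v 0 i|); pose L2 := L + 2 * n.+1%:R.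
pose M := #|{ffun 'I_n.+1 -> J}|.+1; pose K := (2 / cst) ^+ n.+1.
have K0 : 0 < K by rewrite exprn_gt0// divr_gt0.
(* As K e = 1 / (4 M), and with the error g / (4 M) below, the translates of [D] for one choice [a]
   fill on average at most 1 / (2 M) of [G]. There are fewer than M choices, so all of them together
   fill less than half. *)
pose e : R := (4 * M%:R * K)^-1.
have e0 : 0 < e by rewrite invr_gt0 !mulr_gt0.
have e20 : 0 < e / 2 by rewrite divr_gt0.
have [d d0 dP] := outer_measure_flip_small measurable_c L2 e20.
(* So many steps that v / (k + 1) has all coordinates below d in absolute value. *)
pose k := Num.truncn ((1 + \sum_i `|v 0 i|) / d).
pose u := k.+1%:R^-1 *: v; exists u.
have ud l : `|u 0 l| < d.
  rewrite mxE normrM gtr0_norm// mulrC ltr_pdivrMr// mulrC -ltr_pdivrMr//.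
  apply: le_lt_trans (truncnS_gt _).
  by rewrite ler_wpM2r ?invr_ge0 ?(ltW d0)// (le_trans (norm_le_sum v l))// lerDr.
pose G := flip c u `&` window L.
have mG : lebesgue_measurable G.
  apply: caratheodory_measurable_setI; first exact: lebesgue_measurable_flip.
  exact: lebesgue_measurable_window.
have G0 : (0 < mu G)%E by exact: outer_measure_flip_gt0.
have Goo : (mu G < +oo)%E.
  apply: le_lt_trans (outer_measure_window_lty L).
  by apply: lebesgue_outer_measure_subset => x [].
have muG : mu G = (fine (mu G))%:E.
  by rewrite fineK// ge0_fin_numE// lebesgue_outer_measure_ge0.
set g := fine (mu G) in muG; have g0 : 0 < g by rewrite -lte_fin -muG.
pose D := flip c u `&` window L2.
have De : (mu D < e%:E)%E.
  apply: le_lt_trans (dP _ ud) _; rewrite lte_fin ltr_pdivrMr// ltr_pMr//.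
  by rewrite ltr1n.
have e'0 : 0 < g / (4 * M%:R) by rewrite divr_gt0// mulr_gt0.
have [N0 N0P] := smear mG Goo cst0 e'0 De.
exists N0.+1; split => // good0.
pose N := N0.+1; pose I := {ffun 'I_n.+1 -> 'I_N}.
(* If the good points form a null set, then for each [i] almost every point of [G] is led to [D] by
   some choice [a]. *)
have Gle (i : I) : (mu G <= \sum_a mu (shift (walk i a n.+1) D `&` G))%E.
  apply: (@le_trans _ _ (\sum_a mu (shift (walk i a n.+1) D `&` G) +
    \sum_(at' <- index_enum ({ffun 'I_n.+1 -> J} * 'I_n.+1)%type)
      mu (shift (walk i at'.1 at'.2) (good u N)))%E).
    apply: le_trans (leeD (outer_measure_le_sum (@subset_refl _ _))
      (outer_measure_le_sum (@subset_refl _ _))).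
    apply: le_trans (outer_measureU2 _ _ _); apply: lebesgue_outer_measure_subset.
    move=> x [xu xL].
    have [/existsP[at' /asboolP xat]|/existsPn nx] := boolP [exists at' : ({ffun 'I_n.+1 -> J} * 'I_n.+1)%type,
        `[< good u N (x + walk i at'.1 at'.2) >]].
      by right; exists at' => //; exact: mem_index_enum.
    left; have [|a aP] := walk_good xu xL (i := i).
      by move=> a t /asboolP xat; have /negP := nx (a, t); apply.
    by exists a; [exact: mem_index_enum|].
  rewrite [X in (_ + X)%E]big1 ?adde0// => at' _.
  by rewrite lebesgue_outer_measure_shift.
have N0' : 0 < N%:R ^+ n.+1 :> R by rewrite exprn_gt0.
have M0 : 0 < M%:R :> R by [].
have walkT (i : I) (a : {ffun 'I_n.+1 -> J}) :
    walk i a n.+1 = \sum_l gam l ((i l)%:R / N%:R) (a l).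
  by apply: eq_bigl => l; rewrite ltn_ord.
have Sle (a : {ffun 'I_n.+1 -> J}) :
    (\sum_(i : I) mu (shift (walk i a n.+1) D `&` G) <=
      (N%:R ^+ n.+1 * (g / (2 * M%:R)))%:E)%E.
  apply: (le_trans (N0P N I (fun i => walk i a n.+1) _ _ _)) => //.
  - by rewrite card_ffun !card_ord.
  - move=> i j /(gam_sep a (ltn0Sn _))[l il]; exists l; move: il.
    by rewrite !walkT.
  rewrite muG -?EFinM -?EFinD -?EFinM lee_fin ler_pM2l// -/K /e.
  by rewrite le_eqVlt; apply/orP; left; apply/eqP; field; rewrite !gt_eqF.
have : (\sum_(i : I) mu G <= \sum_(a : {ffun 'I_n.+1 -> J})
    (N%:R ^+ n.+1 * (g / (2 * M%:R)))%:E)%E.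
  apply: le_trans (lee_sum _ (fun a _ => Sle a)); rewrite exchange_big/=.
  exact: lee_sum.
rewrite muG !sumEFin lee_fin !sumr_const card_ffun !card_ord -/N.
rewrite -[X in X <= _]mulr_natl -[X in _ <= X]mulr_natl natrX mulrCA ler_pM2l//.
rewrite mulrCA -[X in X <= _]mulr1 ler_pM2l// ler_pdivlMr ?mulr_gt0// mul1r.
rewrite -natrM ler_nat leqNgt => /negP; apply.
by rewrite /M mul2n -addnn addSn ltnS leq_addr.
Qed.

End good_centre.

(** * Moving a configuration by isometries *)

Section separated_curves.
Context {R : realType} {n : nat}.

(** On [0, e] the curve [gam l] has nearly constant velocity [row l T], so the sum of the curves is
    a small perturbation of the invertible linear map T in the parameters. *)
Lemma curves_separated (T : 'M[R]_n.+1) (gam : 'I_n.+1 -> R -> 'rV[R]_n.+1)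
    (e kap : R) : T \in unitmx -> 0 < e -> 0 <= kap ->
  n.+1%:R * kap * (\sum_i \sum_l `|invmx T i l|) <= 2^-1 ->
  (forall l s t i, 0 <= s <= e -> 0 <= t <= e ->
    `|(gam l s - gam l t - (s - t) *: row l T) 0 i| <= kap * `|s - t|) ->
  exists2 c, 0 < c & forall N, (0 < N)%N ->
    separated (c / N%:R) (fun i : {ffun 'I_n.+1 -> 'I_N} =>
      \sum_l gam l (e * ((i l)%:R / N%:R))).
Proof.
set B := \sum_i _ => Tu e0 kap0 kapB gamT.
have B0 : 0 <= B by apply: sumr_ge0 => i _; exact: sumr_ge0.
have B1 : 0 < B + 1 by rewrite ltr_wpDl.
pose c := e / (4 * (B + 1)).
have c0 : 0 < c by rewrite divr_gt0// mulr_gt0.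
exists c => // N N0 i j ij.
have N0' : 0 < N%:R :> R by rewrite ltr0n.
pose h := e / N%:R; have h0 : 0 < h by rewrite divr_gt0.
pose s (i : {ffun 'I_n.+1 -> 'I_N}) l : R := e * ((i l)%:R / N%:R).
have sI k l : 0 <= s k l <= e.
  rewrite /s mulr_ge0 ?(ltW e0) ?divr_ge0//= ger_pMr// ler_pdivrMr// mul1r ler_nat.
  exact: ltnW.
pose del l := s i l - s j l.
(* The axis on which the parameters differ most, by at least one grid step h. If the sums were too
   close, inverting T would bound this difference by h / 4 plus half of itself. *)
pose L := [arg max_(l > 0%R : 'I_n.+1) `|del l|]%O.
have delL l : `|del l| <= `|del L|.
  by rewrite /L; case: Order.TotalTheory.arg_maxP => // L' _; apply.
have hL : h <= `|del L|.
  have [l ijl] : exists l, i l != j l.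
    by apply/existsP; rewrite -negb_forall; apply/negP => /forallP eij;
      move/eqP: ij; apply; apply/ffunP => l; apply/eqP.
  apply: le_trans (delL l); rewrite /del /s -mulrBr -mulrBl mulrCA normrM.
  rewrite [X in _ * X]gtr0_norm// ler_peMl ?(ltW h0)//.
  have [lt|lt|/val_inj lt] := ltngtP (i l) (j l); last by rewrite lt eqxx in ijl.
  - rewrite distrC ger0_norm -?natrB ?ler0n 1?ltnW//.
    by rewrite ler1n subn_gt0.
  - by rewrite -natrB 1?ltnW// ger0_norm ?ler0n// ler1n subn_gt0.
apply: contrapT => /forallNP small.
pose w := (\row_l del l) *m T.
have wE : w = \sum_l del l *: row l T.
  by rewrite /w mulmx_sum_row; apply: eq_bigr => l _; rewrite mxE.
have w_le k : `|w 0 k| <= c / N%:R + n.+1%:R * kap * `|del L|.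
  have -> : w 0 k = ((\sum_l gam l (s i l)) 0 k - (\sum_l gam l (s j l)) 0 k) -
      \sum_l (gam l (s i l) - gam l (s j l) - del l *: row l T) 0 k.
    rewrite wE !summxE -!sumrB; apply: eq_bigr => l _; rewrite !mxE.
    by ring.
  apply: (le_trans (ler_normB _ _)); apply: lerD.
    by have /negP := small k; rewrite -ltNge => /ltW.
  apply: (le_trans (ler_norm_sum _ _ _)).
  apply: (@le_trans _ _ (\sum_(l < n.+1) kap * `|del L|)).
    apply: ler_sum => l _; apply: (le_trans (gamT _ _ _ _ (sI _ _) (sI _ _))).
    by apply: ler_wpM2l => //; exact: delL.
  by rewrite sumr_const card_ord -[X in X <= _]mulr_natl mulrA.
have : `|del L| <= B * (c / N%:R + n.+1%:R * kap * `|del L|).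
  rewrite {1}(_ : del L = (w *m invmx T) 0 L); last by rewrite /w mulmxK// mxE.
  rewrite [X in `|X| <= _]mxE; apply: (le_trans (ler_norm_sum _ _ _)); rewrite /B mulr_suml.
  apply: ler_sum => k _; rewrite normrM mulrC; apply: ler_pM => //.
  by rewrite (bigD1 L)//= lerDl sumr_ge0.
have BC : B * (c / N%:R) <= h / 4.
  rewrite /c /h (_ : B * _ = B / (B + 1) * (e / N%:R / 4)).
    by rewrite ler_piMl ?divr_ge0 ?(ltW e0)// ler_pdivrMr// mul1r lerDl.
  by field; rewrite !gt_eqF.
have BK : B * (n.+1%:R * kap * `|del L|) <= `|del L| / 2.
  by rewrite mulrA mulrC ler_wpM2l// mulrC.
have absurd (a b d g : R) :
    d <= a + b -> a <= g / 4 -> b <= d / 2 -> g <= d -> 0 < g -> False by lra.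
by rewrite mulrDr => /absurd/(_ BC BK hL h0).
Qed.

End separated_curves.

Lemma avoid_roots (R : realType) (J : finType) (P : J -> {poly R}) :
  (forall j, P j != 0) -> exists s, forall j, (P j).[s] != 0.
Proof.
move=> P0; pose Q := \prod_j P j.
have Q0 : Q != 0 by apply/prodf_neq0 => j _.
pose r : seq R := [seq k%:R | k <- iota 0 (size Q)].
have [s sr sQ] : exists2 s, s \in r & ~~ root Q s.
  apply/allPn; apply/negP => rQ.
  have ur : uniq r.
    rewrite map_inj_uniq ?iota_uniq// => k k' /eqP.
    by rewrite eqr_nat => /eqP.
  by have := max_poly_roots Q0 rQ ur; rewrite size_map size_iota ltnn.
exists s => j; apply: contra sQ; rewrite /root /Q (bigD1 j)//= hornerM => /eqP->.
by rewrite mul0r.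
Qed.

(** * Reflections and rotations *)

Section isometries.
Context {R : realType}.

Definition sqn n (u : 'rV[R]_n) := \sum_i u 0 i ^+ 2.
Definition dot n (u v : 'rV[R]_n) := \sum_i u 0 i * v 0 i.

Definition isometry n (f : 'rV[R]_n -> 'rV[R]_n) :=
  {morph f : u v / u - v} /\ forall u, sqn (f u) = sqn u.

Lemma isometry0 n (f : 'rV[R]_n -> 'rV[R]_n) : isometry f -> f 0 = 0.
Proof. by move=> [fB _]; have := fB 0 0; rewrite !subrr. Qed.

Lemma isometry_comp n (f g : 'rV[R]_n -> 'rV[R]_n) :
  isometry f -> isometry g -> isometry (f \o g).
Proof. by move=> [fB fS] [gB gS]; split => [u v|u] /=; rewrite ?gB ?fB// fS. Qed.

Lemma sqnZ n k (u : 'rV[R]_n) : sqn (k *: u) = k ^+ 2 * sqn u.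
Proof. by rewrite /sqn mulr_sumr; apply: eq_bigr => i _; rewrite mxE exprMn. Qed.

Lemma sqnB n (u v : 'rV[R]_n) : sqn (u - v) = sqn u - 2 * dot u v + sqn v.
Proof.
rewrite /sqn /dot mulr_sumr -sumrB -big_split/=; apply: eq_bigr => i _.
by rewrite !mxE; ring.
Qed.

Lemma dotC n (u v : 'rV[R]_n) : dot u v = dot v u.
Proof. by apply: eq_bigr => i _; rewrite mulrC. Qed.

Lemma dotBl n (u v w : 'rV[R]_n) : dot (u - v) w = dot u w - dot v w.
Proof. by rewrite /dot -sumrB; apply: eq_bigr => i _; rewrite !mxE mulrBl. Qed.

Lemma dotZr n k (u v : 'rV[R]_n) : dot u (k *: v) = k * dot u v.
Proof. by rewrite /dot mulr_sumr; apply: eq_bigr => i _; rewrite mxE mulrCA. Qed.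

Lemma dotuu n (u : 'rV[R]_n) : dot u u = sqn u.
Proof. by apply: eq_bigr => i _; rewrite expr2. Qed.

Lemma sqn_eq0 n (u : 'rV[R]_n) : (sqn u == 0) = (u == 0).
Proof.
apply/eqP/eqP => [u0|->]; last by rewrite /sqn big1// => i _; rewrite mxE expr0n.
apply/rowP => i; rewrite mxE; apply/eqP; rewrite -sqrf_eq0.
by rewrite (psumr_eq0P (fun i _ => sqr_ge0 (u 0 i)) u0).
Qed.

Lemma sqn1_neq0 n (u : 'rV[R]_n) : sqn u = 1 -> u != 0.
Proof. by rewrite -sqn_eq0 => ->; rewrite oner_eq0. Qed.

Lemma coord_le1 n (u : 'rV[R]_n) i : sqn u = 1 -> `|u 0 i| <= 1.
Proof.
move=> u1; rewrite -(@ler_pXn2r _ 2)// ?nnegrE// expr1n -normrX ger0_norm ?sqr_ge0//.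
by rewrite -u1 /sqn (bigD1 i)//= lerDl sumr_ge0// => j _; rewrite sqr_ge0.
Qed.

(* For p = 0 the scalar is 0 / 0 = 0 and this is the identity. *)
Definition reflection n (p u : 'rV[R]_n) := u - (2 * dot u p / sqn p) *: p.

Lemma reflection_isometry n (p : 'rV[R]_n) : isometry (reflection p).
Proof.
split=> [u v|u]; rewrite /reflection.
  by rewrite dotBl; apply/rowP => i; rewrite !mxE; ring.
rewrite sqnB sqnZ dotZr; have [p0|p0] := eqVneq (sqn p) 0.
  by rewrite p0 invr0; ring.
by field.
Qed.

Lemma reflection_swap n (u v : 'rV[R]_n) : sqn u = sqn v -> reflection (u - v) u = v.
Proof.
move=> uv; rewrite /reflection.
have [/eqP|uv0] := eqVneq (u - v) 0; first by rewrite subr_eq0 => /eqP->; rewrite subrr scaler0 subr0.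
have -> : 2 * dot u (u - v) = sqn (u - v).
  by rewrite sqnB dotC dotBl dotuu [dot v u]dotC -uv; ring.
by rewrite divff ?sqn_eq0// scale1r opprB addrC subrK.
Qed.

Section rotation.
Context {n : nat}.

(** Cosine and sine of 2 arctan t: the rational parametrization of the circle, with derivatives 0
    and 2 at t = 0. *)
Definition rcos (t : R) := (1 - t ^+ 2) / (1 + t ^+ 2).
Definition rsin (t : R) := 2 * t / (1 + t ^+ 2).

Lemma rden_gt0 (t : R) : 0 < 1 + t ^+ 2.
Proof. by rewrite ltr_pwDl// sqr_ge0. Qed.

Lemma rcos2D_rsin2 t : rcos t ^+ 2 + rsin t ^+ 2 = 1.
Proof. by rewrite /rcos /rsin; field; rewrite gt_eqF ?rden_gt0. Qed.

Definition rotation (l : 'I_n.+1) t (u : 'rV[R]_n.+1) : 'rV[R]_n.+1 := \row_j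
  (if j == 0 then rcos t * u 0 0 - rsin t * u 0 l else
   if j == l then rsin t * u 0 0 + rcos t * u 0 l else u 0 j).

Lemma rotation_isometry l t : l != 0 -> isometry (rotation l t).
Proof.
move=> l0; split=> [u v|u].
  by apply/rowP => j; rewrite !mxE; do 2?case: ifP => _; ring.
rewrite /sqn (bigD1 0)// [RHS](bigD1 0)//= (bigD1 l)//= [in RHS](bigD1 l)//=.
rewrite !mxE eqxx (negPf l0) eqxx !addrA; congr (_ + _).
  rewrite -[RHS]mul1r -(rcos2D_rsin2 t); ring.
by apply: eq_bigr => j /andP[/negPf j0 /negPf jl]; rewrite mxE j0 jl.
Qed.

Lemma rcosB s t : rcos s - rcos t =
  - (2 * (s - t) * (s + t)) / ((1 + s ^+ 2) * (1 + t ^+ 2)).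
Proof. by rewrite /rcos; field; rewrite !gt_eqF ?rden_gt0. Qed.

Lemma rsinB s t : rsin s - rsin t - 2 * (s - t) =
  - (2 * (s - t) * (s ^+ 2 + t ^+ 2 + s ^+ 2 * t ^+ 2 + s * t)) /
  ((1 + s ^+ 2) * (1 + t ^+ 2)).
Proof. by rewrite /rsin; field; rewrite !gt_eqF ?rden_gt0. Qed.

Lemma norm_frac_le (a b e s t : R) : 0 <= b -> b <= e ->
  `|- (2 * a * b) / ((1 + s ^+ 2) * (1 + t ^+ 2))| <= 2 * e * `|a|.
Proof.
move=> b0 be; rewrite mulNr normrN normrM normfV !normrM.
rewrite (ger0_norm b0) [X in _ / (X * _)]gtr0_norm ?rden_gt0//.
rewrite [X in _ / (_ * X)]gtr0_norm ?rden_gt0// [X in X * _ * _ / _]gtr0_norm//.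
rewrite ler_pdivrMr ?mulr_gt0 ?rden_gt0// [2 * e * _]mulrAC.
apply: (@le_trans _ _ (2 * `|a| * e)); first by rewrite ler_wpM2l// mulr_ge0.
rewrite ler_peMr ?mulr_ge0 ?(le_trans b0 be)//.
by rewrite -[X in X <= _]mulr1 ler_pM// lerDl sqr_ge0.
Qed.

Lemma rcosB_le (e s t : R) : 0 <= s <= e -> 0 <= t <= e ->
  `|rcos s - rcos t| <= 4 * e * `|s - t|.
Proof.
move=> /andP[s0 se] /andP[t0 te]; rewrite rcosB.
apply: (le_trans (norm_frac_le _ _ _ (addr_ge0 s0 t0) (lerD se te))).
by rewrite le_eqVlt; apply/orP; left; apply/eqP; ring.
Qed.

Lemma rsinB_le (e s t : R) : e <= 1 -> 0 <= s <= e -> 0 <= t <= e ->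
  `|rsin s - rsin t - 2 * (s - t)| <= 8 * e * `|s - t|.
Proof.
move=> e1 /andP[s0 se] /andP[t0 te]; rewrite rsinB.
have e0 : 0 <= e := le_trans s0 se.
apply: (le_trans (@norm_frac_le _ _ (4 * e) _ _ _ _)).
- by rewrite !addr_ge0 ?mulr_ge0 ?sqr_ge0.
- have s2 : s ^+ 2 <= e by rewrite expr2 -[e]mulr1 ler_pM// (le_trans se).
  have t2 : t ^+ 2 <= e by rewrite expr2 -[e]mulr1 ler_pM// (le_trans te).
  have t1 : t ^+ 2 <= 1 := le_trans t2 e1.
  have st : s * t <= e by rewrite -[e]mulr1 ler_pM// (le_trans te).
  have st2 : s ^+ 2 * t ^+ 2 <= e by rewrite -[e]mulr1 ler_pM ?sqr_ge0.
  lra.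
by rewrite le_eqVlt; apply/orP; left; apply/eqP; ring.
Qed.

(** The derivative of [rotation l t u] at t = 0. *)
Definition tangent (l : 'I_n.+1) (u : 'rV[R]_n.+1) : 'rV[R]_n.+1 := \row_j
  (if j == 0 then - (2 * u 0 l) else if j == l then 2 * u 0 0 else 0).

Lemma rotation_tangent l (e s t : R) u i : sqn u = 1 -> e <= 1 ->
  0 <= s <= e -> 0 <= t <= e ->
  `|(rotation l s u - rotation l t u - (s - t) *: tangent l u) 0 i| <=
    12 * e * `|s - t|.
Proof.
move=> u1 e1 se te; have e0 : 0 <= e by case/andP: se => /le_trans; apply.
have C := rcosB_le se te; have S := rsinB_le e1 se te.
have bound a b : `|a| <= 1 -> `|b| <= 1 ->
    `|(rcos s - rcos t) * a + (rsin s - rsin t - 2 * (s - t)) * b| <= 12 * e * `|s - t|.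
  move=> a1 b1; apply: (le_trans (ler_normD _ _)); rewrite !normrM.
  rewrite (_ : 12 * e * _ = 4 * e * `|s - t| * 1 + 8 * e * `|s - t| * 1); last by ring.
  by apply: lerD; apply: ler_pM.
have ui j : `|u 0 j| <= 1 by exact: coord_le1.
rewrite !mxE; case: ifP => _; last case: ifP => _.
- rewrite (_ : _ - _ - _ = (rcos s - rcos t) * u 0 0 +
    (rsin s - rsin t - 2 * (s - t)) * - u 0 l); last by ring.
  by apply: bound; rewrite ?normrN.
- rewrite (_ : _ - _ - _ = (rcos s - rcos t) * u 0 l +
    (rsin s - rsin t - 2 * (s - t)) * u 0 0); last by ring.
  exact: bound.
by rewrite subrr mulr0 subr0 normr0 !mulr_ge0.
Qed.

End rotation.
End isometries.

(** * Families of isometries in general position *)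

Section generic_reflection.
Context {R : realType} {n : nat} (J : finType) (y : J -> 'rV[R]_n.+2).
Hypothesis y1 : forall j, sqn (y j) = 1.

(** The mirror normal is sought on the moment curve (1, s, s^2, ...). There the coordinate in
    question, multiplied by [sqn p], is the polynomial [P j] in s, so almost every s works once
    [P j] is nonzero. *)
Lemma exists_reflection : exists p, forall j, reflection p (y j) 0 0 != 0.
Proof.
pose P j : {poly R} := \sum_(i < n.+2)
  ((y j 0 0) *: 'X^(i + i) - (2 * y j 0 i) *: 'X^i).
have [|s sP] := @avoid_roots R J P.
  move=> j; apply/negP => /eqP Pj.
  have coefP k : \sum_(i < n.+2)
      (y j 0 0 * (k == i + i)%N%:R - 2 * y j 0 i * (k == i)%:R) = 0.
    rewrite -[RHS](coef0 R k) -Pj /P coef_sum; apply: eq_bigr => i _.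
    by rewrite coefB !coefZ !coefXn.
  (* [y j 0 0] is the coefficient of degree 2 (n + 1); once it vanishes, the coefficient of degree i
     is -2 times coordinate i. *)
  have yj0 : y j 0 0 = 0.
    have := coefP (n.+1 + n.+1)%N; rewrite (bigD1 ord_max)//= eqxx mulr1.
    rewrite (_ : (n.+1 + n.+1 == n.+1)%N = false) ?mulr0 ?subr0; last first.
      by apply/negbTE; rewrite -[X in _ != X]addn0 eqn_add2l.
    rewrite big1 ?addr0// => i ni.
    have il : (i < n.+1)%N.
      by rewrite ltn_neqAle -ltnS ltn_ord andbT; apply: contra ni => /eqP ni; apply/eqP/val_inj.
    rewrite (_ : (_ == i + i)%N = false) ?mulr0; last first.
      by apply: gtn_eqF; rewrite -addSn leq_add// ltnW.
    rewrite (_ : (_ == i :> nat) = false) ?mulr0 ?subr0//.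
    by apply: gtn_eqF; rewrite (leq_trans il)// leq_addr.
  have : y j != 0 by apply: sqn1_neq0.
  apply/negP; rewrite negbK; apply/eqP/rowP => i; rewrite mxE.
  have := coefP i; rewrite yj0 (bigD1 i)//= eqxx big1 => [|i' ii'].
    by rewrite mul0r sub0r mulr1 addr0 => /eqP; rewrite oppr_eq0 mulf_eq0 pnatr_eq0/= => /eqP.
  rewrite mul0r sub0r (_ : (_ == i' :> nat) = false) ?mulr0 ?oppr0//.
  by apply/negbTE; rewrite eq_sym.
pose p : 'rV[R]_n.+2 := \row_i s ^+ i; exists p => j; apply: contra (sP j) => /eqP H.
have sp0 : sqn p != 0.
  by rewrite sqn_eq0; apply/eqP => /rowP/(_ 0); rewrite !mxE expr0 => /eqP; rewrite oner_eq0.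
have -> : (P j).[s] = sqn p * reflection p (y j) 0 0; last by rewrite H mulr0.
rewrite /reflection !mxE expr0 mulr1 mulrBr [_ * (_ / _)]mulrC divfK//.
rewrite /P horner_sum /sqn /dot mulr_sumr mulr_suml -sumrB; apply: eq_bigr => i _.
by rewrite hornerD hornerN !hornerZ !hornerXn !mxE exprD; ring.
Qed.

End generic_reflection.

Section base_angle.
Context {R : realType} {n : nat} (J : finType) (z : J -> 'rV[R]_n.+2).
Hypothesis z0 : forall j, z j 0 0 != 0.

(** Up to the factor 1 + t^2 the determinant is X (1 - t^2) + 2 Y t, with X the cross product and Y
    the dot product of the projections to the first two axes. They cannot both vanish for nonzero
    projections. *)
Lemma exists_base_angle : exists t, forall j k,
  z j 0 0 * rotation 1 t (z k) 0 1 - z j 0 1 * rotation 1 t (z k) 0 0 != 0.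
Proof.
pose X j k := z j 0 0 * z k 0 1 - z j 0 1 * z k 0 0.
pose Y j k := z j 0 0 * z k 0 0 + z j 0 1 * z k 0 1.
pose P (jk : J * J) : {poly R} :=
  X jk.1 jk.2 *: (1 - 'X^2) + (2 * Y jk.1 jk.2) *: 'X.
have [|t tP] := @avoid_roots R _ P.
  move=> [j k]; apply/negP => /eqP Pjk.
  have X0 : X j k = 0.
    have := congr1 (fun p => p.[0]) Pjk.
    by rewrite /P/= !hornerE/= ?(expr0n, subr0, mulr1, mulr0, addr0).
  have Y0 : Y j k = 0.
    have := congr1 (fun p => p.[1]) Pjk.
    rewrite /P/= !hornerE/= ?(expr1n, subrr, mulr0, add0r, mulr1) => /eqP.
    by rewrite mulf_eq0 pnatr_eq0/= => /eqP.
  have : (z j 0 0 ^+ 2 + z j 0 1 ^+ 2) * (z k 0 0) = z j 0 0 * Y j k - z j 0 1 * X j k.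
    by rewrite /X /Y; ring.
  rewrite X0 Y0 !mulr0 subrr => /eqP; rewrite mulf_eq0 (negPf (z0 k)) orbF.
  by rewrite paddr_eq0 ?sqr_ge0// sqrf_eq0 (negPf (z0 j)).
exists t => j k; apply: contra (tP (j, k)) => /eqP H.
have -> : (P (j, k)).[t] = (1 + t ^+ 2) *
    (z j 0 0 * rotation 1 t (z k) 0 1 - z j 0 1 * rotation 1 t (z k) 0 0).
  rewrite /P/= !hornerE !mxE /= /rcos /rsin /X /Y.
  by field; rewrite gt_eqF ?rden_gt0.
by rewrite H mulr0.
Qed.

End base_angle.

Section families.
Context {R : realType} {n : nat} (J : finType) (j0 : J) (y : J -> 'rV[R]_n.+2).
Hypothesis y1 : forall j, sqn (y j) = 1.

(** Only n + 1 coordinate planes contain axis 0, so the plane of axes 0 and 1 serves two families.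
    Column l > 1 has its only nonzero entry in row l; what remains is a 2 by 2 system with the
    determinant of the hypothesis. *)
Lemma unitmx_tangents (z : 'I_n.+2 -> 'rV[R]_n.+2) :
  (forall l, l != 0 -> z l 0 0 != 0) ->
  z 1 0 0 * z 0 0 1 - z 1 0 1 * z 0 0 0 != 0 ->
  \matrix_l tangent (if l == 0 then 1 else l) (z l) \in unitmx.
Proof.
move=> z0 cross; rewrite unitmxE unitfE; apply/negP => /det0P[u u0].
set T := \matrix_l _ => uT.
have uTE k : \sum_l u 0 l * T l k = 0 by have := congr1 (fun v : 'rV[R]_n.+2 => v 0 k) uT; rewrite !mxE.
have ul l : l != 0 -> l != 1 -> u 0 l = 0.
  move=> l0 l1; have := uTE l; rewrite (bigD1 l)//= big1 ?addr0.
    rewrite !mxE (negPf l0) eqxx => /eqP; rewrite !mulf_eq0 pnatr_eq0/=.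
    by rewrite (negPf (z0 _ l0)) orbF => /eqP.
  move=> k kl; rewrite !mxE (negPf l0); case: (k == 0); first by rewrite (negPf l1) mulr0.
  by rewrite eq_sym (negPf kl) mulr0.
have sum2 k : u 0 0 * T 0 k + u 0 1 * T 1 k = 0.
  rewrite -(uTE k) (bigD1 0)//= (bigD1 1)//= big1 ?addr0//.
  by move=> l /andP[l0 l1]; rewrite ul// mul0r.
have := sum2 0; have := sum2 1; rewrite !mxE !eqxx /= => e1 e0.
have E0 : u 0 0 * (z 1 0 0 * z 0 0 1 - z 1 0 1 * z 0 0 0) = 0.
  have := congr1 ( *%R (z 1 0 0)) e0; have := congr1 ( *%R (z 1 0 1)) e1.
  rewrite !mulr0; lra.
have E1 : u 0 1 * (z 1 0 0 * z 0 0 1 - z 1 0 1 * z 0 0 0) = 0.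
  have := congr1 ( *%R (z 0 0 0)) e0; have := congr1 ( *%R (z 0 0 1)) e1.
  rewrite !mulr0; lra.
have u00 : u 0 0 = 0 by move/eqP: E0; rewrite mulf_eq0 (negPf cross) orbF => /eqP.
have u01 : u 0 1 = 0 by move/eqP: E1; rewrite mulf_eq0 (negPf cross) orbF => /eqP.
apply/negP: u0; rewrite negbK; apply/eqP/rowP => l; rewrite mxE.
have [->//|l0] := eqVneq l 0; have [->//|l1] := eqVneq l 1; exact: ul.
Qed.

Lemma exists_families : exists F : 'I_n.+2 -> R -> 'rV[R]_n.+2 -> 'rV[R]_n.+2,
  (forall l t, isometry (F l t)) /\
  exists2 c, 0 < c & forall N (a : {ffun 'I_n.+2 -> J}), (0 < N)%N ->
    separated (c / N%:R) (fun i : {ffun 'I_n.+2 -> 'I_N} =>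
      \sum_l F l ((i l)%:R / N%:R) (y (a l))).
Proof.
have [p yp] := exists_reflection y1.
have [th thP] := exists_base_angle yp.
pose ax (l : 'I_n.+2) := if l == 0 then 1 else l.
have ax0 l : ax l != 0.
  by rewrite /ax; case: (eqVneq l 0) => [_|l0]; [exact: oner_neq0|exact: l0].
pose base (l : 'I_n.+2) u := if l == 0 then rotation 1 th (reflection p u) else reflection p u.
have base_isom l : isometry (base l).
  rewrite /base; case: (l == 0); last exact: reflection_isometry.
  apply: (@isometry_comp _ _ (rotation 1 th) (reflection p)).
    by apply: rotation_isometry; rewrite oner_eq0.
  exact: reflection_isometry.
pose z (a : {ffun 'I_n.+2 -> J}) l := base l (y (a l)).
have z1 a l : sqn (z a l) = 1 by rewrite (base_isom l).2.
pose T a := \matrix_l tangent (ax l) (z a l).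
have Tu a : T a \in unitmx.
  apply: unitmx_tangents => [l l0|]; first by rewrite /z /base (negPf l0) yp.
  exact: thP.
pose B a := \sum_i \sum_l `|invmx (T a) i l|.
have B0 a : 0 <= B a by apply: sumr_ge0 => i _; exact: sumr_ge0.
have [a|e e0 eP] := uniform_pos (I := {ffun 'I_n.+2 -> J}) (P := fun a e =>
    e <= 1 /\ n.+2%:R * (12 * e) * B a <= 2^-1).
  (* 24 is twice the constant 12 of [rotation_tangent], which yields the bound 2^-1 required by
     [curves_separated]. *)
  exists (24 * n.+2%:R * (B a + 1))^-1; first by rewrite invr_gt0 !mulr_gt0// ltr_wpDl.
  have D0 : 0 < 24 * n.+2%:R * (B a + 1) by rewrite !mulr_gt0// ltr_wpDl.
  move=> e /andP[e0 eB]; split.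
    apply: (le_trans eB); rewrite invf_le1//.
    by rewrite -!natrM -[X in X <= _]mulr1 ler_pM// ?ler1n// lerDr.
  have : e * (24 * n.+2%:R * (B a + 1)) <= 1 by rewrite -ler_pdivlMr// mul1r.
  have : 0 <= e * n.+2%:R by rewrite mulr_ge0// ltW.
  move: (B0 a) e0; move: (B a) => b b0 e0 en0 eb.
  rewrite (_ : _ * _ * b = 12 * (e * n.+2%:R * b)); last by ring.
  have : e * n.+2%:R * b <= e * n.+2%:R * (b + 1) by rewrite ler_wpM2l// lerDl.
  lra.
(* [j0] supplies one choice function, from which the bound on e alone is read off. *)
have [e1 _] : e <= 1 /\ n.+2%:R * (12 * e) * B [ffun=> j0] <= 2^-1.
  by apply: eP; rewrite e0 lexx.
pose F l t u := rotation (ax l) (e * t) (base l u).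
exists F; split.
  move=> l t; apply: (@isometry_comp _ _ (rotation (ax l) (e * t)) (base l)) => //.
  exact: rotation_isometry.
have [a|c c0 cP] := uniform_pos (I := {ffun 'I_n.+2 -> J}) (P := fun a c =>
    forall N, (0 < N)%N -> separated (c / N%:R) (fun i : {ffun 'I_n.+2 -> 'I_N} =>
      \sum_l F l ((i l)%:R / N%:R) (y (a l)))).
  have [_ eB] : e <= 1 /\ n.+2%:R * (12 * e) * B a <= 2^-1.
    by apply: eP; rewrite e0 lexx.
  have e12 : 0 <= 12 * e by rewrite mulr_ge0// ltW.
  have [|c c0 cP] := @curves_separated R n.+1 (T a)
      (fun l t => rotation (ax l) t (z a l)) e (12 * e) (Tu a) e0 e12 eB.
    move=> l s t i se te; rewrite (_ : row l (T a) = tangent (ax l) (z a l)).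
      exact: rotation_tangent.
    by apply/rowP => k; rewrite !mxE.
  exists c => // d /andP[d0 dc] N N0 i i' /(cP N N0)[k ik]; exists k.
  by apply: le_trans ik; rewrite ler_wpM2r.
exists c => // N a N0; apply: (cP a c) => //.
by rewrite c0 lexx.
Qed.

End families.

(** * Bichromatic centres *)

Section rigid.
Context {R : realType} {n m : nat} (c : 'rV[R]_n.+2 -> 'I_m).
Hypothesis measurable_c : forall i, lebesgue_measurable [set x | c x = i].
Hypothesis unit_flip : forall v, sqn v = 1 ->
  lebesgue_outer_measure (~` flip c v) = 0%E.
Local Notation mu := (@lebesgue_outer_measure R n.+2).

(** [kap] is the colouring [c] seen on a moved copy of V around a good point x, and the two colours
    of the centre are those of x and x + u. *)
Lemma bichromatic_centre (V : seq 'rV[R]_n.+2) :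
  exists (i1 i2 : 'I_m) (kap : 'rV[R]_n.+2 -> 'I_m), [/\ i1 != i2,
    {in V &, forall u v, sqn (v - u) = 1 -> kap u != kap v} &
    {in V, forall u, sqn u = 1 -> kap u != i1 /\ kap u != i2}].
Proof.
(* A unit vector that keeps the configuration nonempty and also serves as the direction of the small
   translation. *)
pose e0 : 'rV[R]_n.+2 := \row_i (i == 0)%:R.
have e01 : sqn e0 = 1.
  rewrite /sqn (bigD1 0)//= mxE eqxx expr1n big1 ?addr0// => i /negPf i0.
  by rewrite mxE i0 expr0n.
pose B := e0 :: [seq u <- V | sqn u == 1].
pose y (j : 'I_(size B)) := nth 0 B j.
have y1 j : sqn (y j) = 1.
  apply/eqP; apply: (@all_nthP _ (fun u => sqn u == 1) B 0 _ _ _); last exact: ltn_ord.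
  by rewrite /= e01 eqxx filter_all.
pose j0 : 'I_(size B) := ord0.
have [F [Fi [cst cst0 Fsep]]] := exists_families j0 y1.
have F1 l (t : R) j i : 0 <= t <= 1 -> `|F l t (y j) 0 i| <= 1.
  by move=> _; apply: coord_le1; rewrite (Fi l t).2.
have [u [N [N0 good0]]] := good_centre measurable_c j0
  (gam := fun l t j => F l t (y j)) F1 cst0 (fun N a => Fsep N a) (unit_flip e01).
pose P := [seq pq <- [seq (p, q) | p <- 0 :: V, q <- 0 :: V] | sqn (pq.2 - pq.1) == 1].
pose G (li : 'I_n.+2 * 'I_N) := F li.1 ((li.2)%:R / N%:R).
pose K := [seq (li, pq) | li <- index_enum ('I_n.+2 * 'I_N)%type, pq <- P].
(* The points x for which the pair p, q at distance 1 gets equal colours in the copy around x or in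
   the one around x + u. Finitely many such null sets are avoided, as the good points do not form a
   null set. *)
pose Z (k : ('I_n.+2 * 'I_N) * ('rV[R]_n.+2 * 'rV[R]_n.+2)) :=
  shift (G k.1 k.2.1) (~` flip c (G k.1 k.2.2 - G k.1 k.2.1)) `|`
  shift (u + G k.1 k.2.1) (~` flip c (G k.1 k.2.2 - G k.1 k.2.1)).
have Z0 k : k \in K -> mu (Z k) = 0%E.
  case/allpairsP => -[li [p q]] /= [_]; rewrite mem_filter => /andP[/eqP pq _] ->.
  have uf : mu (~` flip c (G li q - G li p)) = 0%E.
    by apply: unit_flip; rewrite -(Fi _ _).1 (Fi _ _).2.
  apply/eqP; rewrite eq_le lebesgue_outer_measure_ge0 andbT.
  apply: (@le_trans _ _ (mu (shift (G li p) (~` flip c (G li q - G li p))) +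
    mu (shift (u + G li p) (~` flip c (G li q - G li p))))%E).
    exact: outer_measureU2.
  by rewrite !lebesgue_outer_measure_shift uf adde0.
have [x [[xu [l [i xi]]] xZ]] : exists x, good c (fun l t j => F l t (y j)) u N x /\
    forall k, k \in K -> ~ Z k x.
  apply: contrapT => nx; apply: good0; apply/eqP.
  rewrite eq_le lebesgue_outer_measure_ge0 andbT.
  apply: (@le_trans _ _ (\sum_(k <- K) mu (Z k))%E).
    apply: outer_measure_le_sum => x xg; apply: contrapT => xK; apply: nx.
    by exists x; split => // k kK xk; apply: xK; exists k.
  by rewrite big_seq big1// => k /Z0.
pose g := G (l, i).
have properx p q : p \in 0 :: V -> q \in 0 :: V -> sqn (q - p) = 1 ->
    c (x + g p) <> c (x + g q) /\ c (x + u + g p) <> c (x + u + g q).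
  move=> pV qV pq; have kK : ((l, i), (p, q)) \in K.
    apply/allpairsP; exists ((l, i), (p, q)); split => //=; first exact: mem_index_enum.
    rewrite mem_filter; apply/andP; split; first by apply/eqP.
    exact: (allpairs_f (fun p q => (p, q)) pV qV).
  have := xZ _ kK; rewrite /Z/= => nZ; split => cpq; apply: nZ; [left|right].
    by rewrite /shift/flip/= addrACA subrr addr0 => /(_ cpq).
  by rewrite /shift/flip/= addrA addrACA subrr addr0 => /(_ cpq).
exists (c x), (c (x + u)), (fun v => c (x + g v)); split.
- exact/eqP.
- move=> p q pV qV pq; apply/eqP; apply: (properx p q _ _ pq).1;
  by rewrite inE ?pV ?qV orbT.
- move=> q qV q1.
  have [qj Hqj] : exists j, q = y j.
    have qB : q \in B by rewrite inE mem_filter q1 eqxx qV orbT.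
    by exists (Ordinal (etrans (index_mem _ _) qB)); rewrite /y/= nth_index.
  have [c1 c2] : c (x + g 0) <> c (x + g q) /\ c (x + u + g 0) <> c (x + u + g q).
    by apply: properx; rewrite ?mem_head ?subr0// inE qV orbT.
  have g0 : g 0 = 0 by exact: isometry0 (Fi _ _).
  rewrite g0 !addr0 in c1 c2.
  (* As x + g q avoids [flip c u], its colour is subject to the constraints of both centres x and x
     + u. *)
  have cq : c (x + g q) = c (x + u + g q).
    by have /contrapT := xi qj; rewrite -Hqj addrAC.
  by split; apply/eqP => cc; [apply: c1|apply: c2; rewrite -cq].
Qed.

End rigid.

(** * Configurations without bichromatic centres *)

Section simplices.
Context {R : realType} {n : nat}.
Local Notation d := n.+3.

Let one : 'rV[R]_d := const_mx 1.
Let e (i : 'I_d) : 'rV[R]_d := \row_j (j == i)%:R.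
(** The factor that puts the basis vectors at mutual distance 1. *)
Let al : R := Num.sqrt 2^-1.

Lemma sqn_axis_diag (i : 'I_d) a b :
  sqn (a *: e i + b *: one) = a ^+ 2 + 2 * a * b + d%:R * b ^+ 2.
Proof.
rewrite /sqn (bigD1 i)//= (eq_bigr (fun=> b ^+ 2)) => [|j /negPf ji].
  rewrite !mxE eqxx sumr_const cardC1 card_ord -[X in _ + X]mulr_natl -[d%:R]natr1.
  by rewrite mulr1n /=; ring.
by rewrite !mxE ji mulr0 add0r mulr1.
Qed.

Lemma sqn_axisB (i j : 'I_d) b : i != j ->
  sqn ((al *: e i + b *: one) - (al *: e j + b *: one)) = 1.
Proof.
move=> ij; have -> : (al *: e i + b *: one) - (al *: e j + b *: one) = al *: (e i - e j).
  by apply/rowP => k; rewrite !mxE; ring.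
rewrite sqnZ sqr_sqrtr// sqnB /sqn /dot.
rewrite (bigD1 i)//= big1 => [|k /negPf ki]; last by rewrite !mxE ki expr0n.
rewrite (bigD1 i)//= big1 => [|k /negPf ki]; last by rewrite !mxE ki mul0r.
rewrite (bigD1 j)//= big1 => [|k /negPf ki]; last by rewrite !mxE ki expr0n.
by rewrite !mxE !eqxx (negPf ij) mulr0 !addr0 mulr0 subr0 expr1n; field.
Qed.

(* [w a] is the mirror image of the origin in the facet spanned by [y a]. *)
Lemma exists_simplices : exists (y : 'I_3 -> 'I_d -> 'rV[R]_d) (w : 'I_3 -> 'rV[R]_d),
  [/\ forall a i, sqn (y a i) = 1,
      forall a i j, i != j -> sqn (y a i - y a j) = 1,
      forall a i, sqn (w a - y a i) = 1 &
      forall a b, a != b -> sqn (w a - w b) = 1].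
Proof.
have d0 : 0 < d%:R :> R by [].
have al2 : al ^+ 2 = 2^-1 by rewrite sqr_sqrtr.
(* [ga] is the coordinate sum of each [y i] below, chosen to give [y i] norm 1. The mirror image [w]
   of the origin in their hyperplane has coordinate sum 2 [ga], whence [rho]; [r2] is its squared
   norm. *)
pose ga : R := Num.sqrt (2^-1 + d%:R / 2).
have ga2 : ga ^+ 2 = 2^-1 + d%:R / 2 by rewrite sqr_sqrtr// addr_ge0// divr_ge0.
pose be := (ga - al) / d%:R; pose rho := 2 * ga / d%:R.
pose r2 := d%:R * rho ^+ 2.
have r2E : r2 = 2 + 2 / d%:R.
  rewrite /r2 /rho expr_div_n exprMn ga2; field; lra.
(* The coordinate sum of [w' a], chosen so that [w' a] is as long as [w]. The reflection that swaps
   the two carries the simplex to one whose mirror image is [w' a]. *)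
pose de : R := Num.sqrt (2^-1 + d%:R * (r2 - 2^-1)).
have de2 : de ^+ 2 = 2^-1 + d%:R * (r2 - 2^-1).
  rewrite sqr_sqrtr// addr_ge0// mulr_ge0// r2E.
  have : 0 <= 2 / d%:R :> R by rewrite divr_ge0.
  move: (2 / d%:R) => z z0; lra.
pose t := (de - al) / d%:R.
pose y i := al *: e i + be *: one; pose w := rho *: one.
pose w' (a : 'I_3) := al *: e (widen_ord (isT : (3 <= d)%N) a) + t *: one.
have ww' a : sqn w = sqn (w' a).
  have -> : w = 0 *: e ord0 + rho *: one by rewrite scale0r add0r.
  rewrite !sqn_axis_diag al2.
  rewrite (_ : _ + d%:R * t ^+ 2 = 2^-1 + (de ^+ 2 - al ^+ 2) / d%:R); last first.
    by rewrite /t; field; lra.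
  rewrite de2 al2 -/r2; field; lra.
exists (fun a i => reflection (w - w' a) (y i)), w'; split.
- move=> a i; rewrite (reflection_isometry _).2 sqn_axis_diag al2.
  rewrite (_ : _ + d%:R * be ^+ 2 = 2^-1 + (ga ^+ 2 - al ^+ 2) / d%:R); last first.
    by rewrite /be; field; lra.
  by rewrite ga2 al2; field; lra.
- move=> a i j ij; rewrite -(reflection_isometry _).1 (reflection_isometry _).2.
  exact: sqn_axisB.
- move=> a i; rewrite -{1}(reflection_swap (ww' a)).
  rewrite -(reflection_isometry _).1 (reflection_isometry _).2.
  have -> : w - y i = (- al) *: e i + (rho - be) *: one.
    by apply/rowP => k; rewrite !mxE; ring.
  rewrite sqn_axis_diag sqrrN.
  rewrite (_ : _ + d%:R * _ ^+ 2 = al ^+ 2 + (ga ^+ 2 - al ^+ 2) / d%:R); last first.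
    by rewrite /be /rho; field; lra.
  by rewrite ga2 al2; field; lra.
- by move=> a b ab; apply: sqn_axisB; apply: contra ab => /eqP/(congr1 val) ab; apply/eqP/val_inj.
Qed.

Lemma no_bichromatic_centre_ge3 : exists V : seq 'rV[R]_d,
  forall (i1 i2 : 'I_(d + 2)) (kap : 'rV[R]_d -> 'I_(d + 2)), i1 != i2 ->
    {in V &, forall u v, sqn (v - u) = 1 -> kap u != kap v} ->
    {in V, forall u, sqn u = 1 -> kap u != i1 /\ kap u != i2} -> False.
Proof.
have [y [w [y1 yy wy ww]]] := exists_simplices.
exists ([seq y a i | a <- enum 'I_3, i <- enum 'I_d] ++ [seq w a | a <- enum 'I_3]).
move=> i1 i2 kap i12 proper away; set V := _ ++ _ in proper away.
have yV a i : y a i \in V by rewrite mem_cat allpairs_f ?mem_enum.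
have wV a : w a \in V by rewrite mem_cat map_f ?mem_enum ?orbT.
(* The d facet vertices have distinct colours other than [i1] and [i2], so [s] lists all d + 2
   colours and the mirror image is left with these two. *)
have kw a : (kap (w a) == i1) || (kap (w a) == i2).
  pose s := [:: i1, i2 & [seq kap (y a i) | i <- enum 'I_d]].
  have us : uniq s.
    rewrite /= inE negb_or i12/=; apply/and3P; split.
    - by apply/mapP => -[i _ ei]; have [] := away _ (yV a i) (y1 a i); rewrite ei eqxx.
    - by apply/mapP => -[i _ ei]; have [] := away _ (yV a i) (y1 a i); rewrite ei eqxx.
    - rewrite map_inj_uniq ?enum_uniq// => i j ij; apply/eqP/negPn/negP => nij.
      have := proper _ _ (yV a j) (yV a i) (yy a i j nij).
      by rewrite ij eqxx.
  have ss : {subset s <= enum 'I_(d + 2)} by move=> k _; rewrite mem_enum.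
  have sz : (size (enum 'I_(d + 2)) <= size s)%N.
    by rewrite size_enum_ord /= size_map size_enum_ord addn2.
  have [_ sE] := uniq_min_size us ss sz.
  have : kap (w a) \in s by rewrite sE mem_enum.
  rewrite !inE => /or3P[->//|->|/mapP[i _ ei]]; first by rewrite orbT.
  by have := proper _ _ (yV a i) (wV a) (wy a i); rewrite ei eqxx.
have kww a b : a != b -> kap (w b) != kap (w a).
  by move=> ab; exact: proper _ _ (wV b) (wV a) (ww a b ab).
have := kww ord0 1 isT; have := kww 1 ord_max isT; have := kww ord0 ord_max isT.
move: (kw ord0) (kw 1) (kw ord_max).
by do 3!case/orP=> /eqP->; rewrite eqxx.
Qed.

End simplices.

(* (a, b, c, d) stands for the complex number (a + b zeta) + eta (c + d zeta),
   where zeta and eta are the unit numbers of real parts 1/2 and 5/6. *)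
Notation quad := (int * int * int * int)%type.

(* The squared distance is rational only if the irrational part
   sqrt 33 (a d - b c) / 6 vanishes. *)
Definition neighbour (p q : quad) : bool :=
  let: (a, b, c, d) := p in let: (a', b', c', d') := q in
  let a := a - a' in let b := b - b' in let c := c - c' in let d := d - d' in
  (6%:Z * (a * a + a * b + b * b + c * c + c * d + d * d) +
   5%:Z * (2%:Z * (a * c + b * d) + a * d + b * c) == 6%:Z) && (a * d == b * c).

(** The power zeta^k in the basis 1, zeta, using zeta^2 = zeta - 1. *)
Definition eisenstein (k : nat) : int * int :=
  nth (0, 0) [:: (1, 0); (0, 1); (-1, 1); (-1, 0); (0, -1); (1, -1)] (k %% 6).

(** The first twelve points are unit vectors, where only two of the four colours remain; placing
    them first keeps the search small. *)
Definition planar_points : seq quad :=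
  let pt (u v : int * int) : quad := (u.1, u.2, v.1, v.2) in
  let z := eisenstein in
  [seq pt (z k) (0, 0) | k <- iota 0 6] ++ [seq pt (0, 0) (z k) | k <- iota 0 6] ++
  [seq pt (z k.+1) (z (k + 4)%N) | k <- [:: 0; 2; 4]%N] ++
  [seq pt (z k) (z k.+2) | k <- [:: 0; 2; 4]%N] ++
  [seq pt (z k.+2) (z k) | k <- [:: 0; 2; 4]%N] ++
  [seq pt (z k + z k.+1) (z (k + 4)%N) | k <- [:: 0; 2; 4]%N] ++
  [seq pt (z k.+1 + z k.+2) (z (k + 4)%N) | k <- [:: 0; 2; 4]%N].

Definition colours := iota 0 4.

Definition admissible (i1 i2 : nat) (col : seq (quad * nat)) v k :=
  (neighbour v (0, 0, 0, 0) ==> (k != i1) && (k != i2)) &&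
  all (fun wl => neighbour v wl.1 ==> (wl.2 != k)) col.

(* [if], not [&&]: the call-by-value evaluation of [&&] would explore all branches. *)
Fixpoint extendable (i1 i2 : nat) (col : seq (quad * nat)) (todo : seq quad) :=
  if todo is v :: todo' then
    has (fun k => if admissible i1 i2 col v k
      then extendable i1 i2 ((v, k) :: col) todo' else false) colours
  else true.

(** Soundness of the search: the branch that follows f passes every test. *)
Lemma extendable_colouring i1 i2 (f : quad -> nat) done todo :
  (forall v, (f v < 4)%N) ->
  {in done ++ todo &, forall v w, neighbour v w -> f v <> f w} ->
  {in done ++ todo, forall v, neighbour v (0, 0, 0, 0) -> f v <> i1 /\ f v <> i2} ->
  extendable i1 i2 [seq (v, f v) | v <- done] todo.
Proof.
move=> f4; elim: todo done => [//|v todo IH] done proper away.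
suff : has (fun k => if admissible i1 i2 [seq (v, f v) | v <- done] v k
    then extendable i1 i2 ((v, k) :: [seq (v, f v) | v <- done]) todo else false)
    colours by [].
apply/hasP; exists (f v); first by rewrite /colours mem_iota f4.
have vin : v \in done ++ v :: todo by rewrite mem_cat mem_head orbT.
have -> : admissible i1 i2 [seq (v, f v) | v <- done] v (f v).
  apply/andP; split; first by apply/implyP => /(away _ vin)[/eqP/negPf-> /eqP/negPf->].
  apply/allP => _ /mapP[w wd ->]; apply/implyP => vw /=.
  by rewrite eq_sym; apply/eqP; apply: proper => //; rewrite mem_cat wd.
have perm w : (w \in (v :: done) ++ todo) = (w \in done ++ v :: todo).
  by rewrite /= !(inE, mem_cat) orbCA.
apply: (IH (v :: done)) => [w w'|w]; rewrite !perm; [exact: proper|exact: away].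
Qed.

Lemma planar_points_not_extendable i1 i2 : (i1 < 4)%N -> (i2 < 4)%N -> i1 != i2 ->
  ~~ extendable i1 i2 [::] planar_points.
Proof.
(* All ordered pairs of colours are tried; the [if] disposes of equal colours without a search. *)
have check : all (fun i1 => all (fun i2 => if i1 == i2 then true else
    ~~ extendable i1 i2 [::] planar_points) colours) colours by vm_compute.
move=> lt1 lt2 /negPf ne.
have c1 : i1 \in colours by rewrite /colours mem_iota.
have c2 : i2 \in colours by rewrite /colours mem_iota.
move: (allP (allP check i1 c1) i2 c2); rewrite ne.
exact (fun h => h).
Qed.

Section plane.
Context {R : realType}.

(** Here eta zeta has real part (5 - sqrt 33) / 12 and imaginary part (5 sqrt 3 + sqrt 11) / 12.
    Writing sqrt 33 as a product leaves only two radicals to eliminate. *)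
Definition plane_vector (a b c d : R) : 'rV[R]_2 := \row_j
  (if j == 0 then a + b / 2 + c * (5 / 6) +
     d * (5 - Num.sqrt 3 * Num.sqrt 11) / 12
   else Num.sqrt 3 * (b / 2 + d * (5 / 12)) + Num.sqrt 11 * (c / 6 + d / 12)).

Lemma sqn_plane_vector (a b c d : R) : a * d = b * c ->
  sqn (plane_vector a b c d) = a * a + a * b + b * b + c * c + c * d + d * d +
    5 / 6 * (2 * (a * c + b * d) + a * d + b * c).
Proof.
move=> adbc; rewrite /sqn !big_ord_recl big_ord0 !mxE/= addr0.
have s3 : Num.sqrt 3 ^+ 2 = 3 :> R by rewrite sqr_sqrtr.
have s11 : Num.sqrt 11 ^+ 2 = 11 :> R by rewrite sqr_sqrtr.
move: (Num.sqrt 3) (Num.sqrt 11) s3 s11 => x y x2 y2.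
have -> : a + b / 2 + c * (5 / 6) + d * (5 - x * y) / 12 =
  a + b / 2 + c * (5 / 6) + d * (5 / 12) - d * (x * y) / 12 by field.
transitivity ((a + b / 2 + c * (5 / 6) + d * (5 / 12)) ^+ 2 +
  d ^+ 2 * (x ^+ 2 * y ^+ 2) / 144 + x ^+ 2 * (b / 2 + d * (5 / 12)) ^+ 2 +
  y ^+ 2 * (c / 6 + d / 12) ^+ 2 + x * y * (b * c - a * d) / 6); first by field.
have -> : b * c - a * d = 0 by rewrite adbc subrr.
by rewrite x2 y2 mulr0 mul0r; field.
Qed.

Lemma no_bichromatic_centre_2 : exists V : seq 'rV[R]_2,
  forall (i1 i2 : 'I_(2 + 2)) (kap : 'rV[R]_2 -> 'I_(2 + 2)), i1 != i2 ->
    {in V &, forall u v, sqn (v - u) = 1 -> kap u != kap v} ->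
    {in V, forall u, sqn u = 1 -> kap u != i1 /\ kap u != i2} -> False.
Proof.
pose emb (p : quad) : 'rV[R]_2 := let: (a, b, c, d) := p in
  plane_vector a%:~R b%:~R c%:~R d%:~R.
have sqn_emb p q : neighbour p q -> sqn (emb p - emb q) = 1.
  case: p q => [[[a b] c] d] [[[a' b'] c'] d'] /andP[/eqP e1 /eqP e2].
  have -> : emb (a, b, c, d) - emb (a', b', c', d') =
      plane_vector (a - a')%:~R (b - b')%:~R (c - c')%:~R (d - d')%:~R.
    by apply/rowP => j; rewrite !mxE !rmorphB /=; case: ifP => _; field.
  move: (a - a') (b - b') (c - c') (d - d') e1 e2 => {}a {}b {}c {}d e1 e2.
  rewrite sqn_plane_vector; last by rewrite -!rmorphM e2.
  have := congr1 (fun z : int => z%:~R : R) e1.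
  rewrite !(rmorphD, rmorphM)/=; lra.
have emb0 : emb (0, 0, 0, 0) = 0 by apply/rowP => j; rewrite !mxE; case: ifP => _; field.
exists [seq emb p | p <- planar_points] => i1 i2 kap i12 proper away.
apply: (negP (planar_points_not_extendable (ltn_ord i1) (ltn_ord i2) i12)).
apply: (@extendable_colouring _ _ (fun p => kap (emb p) : nat) [::]) => //.
- move=> p q pP qP pq; apply/eqP; rewrite eq_sym; apply: proper; rewrite ?map_f//.
  exact: sqn_emb.
- move=> p pP p0; have [||k1 k2] := away (emb p); first exact: map_f.
    by rewrite -[emb p]subr0 -emb0; exact: sqn_emb.
  by split; apply/eqP.
Qed.

End plane.

(** * Rational unit vectors *)

Section rational_unit_vectors.
Context {R : realType} {n : nat}.

Lemma cvg_sum_seq (I : finType) (f : I -> nat -> R) (a : I -> R) :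
  (forall i, f i @ \oo --> a i) -> (fun k => \sum_i f i k) @ \oo --> \sum_i a i.
Proof.
move=> fa; elim: (index_enum I) => [|i s IH].
  rewrite big_nil (_ : (fun _ => _) = fun=> 0); first exact: cvg_cst.
  by apply/funext => k; rewrite big_nil.
rewrite big_cons (_ : (fun _ => _) = f i \+ (fun k => \sum_(j <- s) f j k)).
  exact: cvgD.
by apply/funext => k; rewrite big_cons.
Qed.

(** The reflection in e0 - v takes the basis vector e0 to v. Replacing e0 - v by a nearby rational
    vector gives a rational unit vector, close to v by continuity; the case v = e0, where the normal
    vanishes, is settled first. *)
Lemma rational_unit_vector_near (v : 'rV[R]_n.+1) (d : R) : sqn v = 1 -> 0 < d ->
  exists q : 'rV[rat]_n.+1, sqn (map_mx ratr q : 'rV[R]_n.+1) = 1 /\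
    forall l, `|(map_mx ratr q - v) 0 l| < d.
Proof.
move=> v1 d0; pose e0 (F : fieldType) : 'rV[F]_n.+1 := \row_j (j == 0)%:R.
have e01 : sqn (e0 R) = 1.
  rewrite /sqn (bigD1 0)//= mxE eqxx expr1n big1 ?addr0// => i /negPf i0.
  by rewrite mxE i0 expr0n.
have [ev|ev] := eqVneq (e0 R - v) 0.
  move/eqP: ev; rewrite subr_eq0 => /eqP <-; exists (e0 rat).
  have -> : map_mx ratr (e0 rat) = e0 R by apply/rowP => j; rewrite !mxE ratr_nat.
  by split => // l; rewrite subrr mxE normr0.
set p := e0 R - v in ev.
have /choice[Q QP] (k : nat) : exists q : 'rV[rat]_n.+1,
    forall i, `|p 0 i - ratr (q 0 i)| < k.+1%:R^-1.
  have /choice[q qP] (i : 'I_n.+1) : exists q : rat, `|p 0 i - ratr q| < k.+1%:R^-1.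
    have : p 0 i < p 0 i + k.+1%:R^-1 by rewrite ltrDl invr_gt0.
    move=> /rat_in_itvoo[q]; rewrite in_itv/= => /andP[q1 q2]; exists q.
    by rewrite distrC gtr0_norm ?subr_gt0// ltrBlDl.
  by exists (\row_i q i) => i; rewrite mxE.
have Qp i : (fun k => ratr (Q k 0 i) : R) @ \oo --> p 0 i.
  apply/cvgrPdist_lt => e e_gt0; near=> k; apply: lt_le_trans (QP k i) _.
  near: k; exists (Num.truncn e^-1) => // k /= ek.
  rewrite -[leRHS]invrK lef_pV2 ?posrE ?invr_gt0//.
  by rewrite (le_trans (ltW (truncnS_gt _)))// ler_nat.
have sQ : (fun k => \sum_i (ratr (Q k 0 i) : R) ^+ 2) @ \oo --> sqn p.
  by apply: cvg_sum_seq => i; rewrite expr2; under eq_fun do rewrite expr2; exact: cvgM.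
have dot0 (w : 'rV[R]_n.+1) : dot (e0 R) w = w 0 0.
  rewrite /dot (bigD1 0)//= mxE eqxx mul1r big1 ?addr0// => i /negPf i0.
  by rewrite mxE i0 mul0r.
have coordQ l : (fun k => reflection (map_mx ratr (Q k)) (e0 R) 0 l) @ \oo --> v 0 l.
  have -> : v = reflection p (e0 R) by rewrite reflection_swap// e01.
  rewrite (_ : (fun _ => _) = fun k => e0 R 0 l -
      2 * ratr (Q k 0 0) / (\sum_i (ratr (Q k 0 i) : R) ^+ 2) * ratr (Q k 0 l)); last first.
    apply/funext => k; rewrite /reflection dot0 !mxE; congr (_ - 2 * _ / _ * _).
    by apply: eq_bigr => i _; rewrite !mxE.
  rewrite (_ : reflection p (e0 R) 0 l = e0 R 0 l - 2 * p 0 0 / sqn p * p 0 l); last first.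
    by rewrite /reflection dot0 [LHS]mxE [X in _ + X]mxE [X in - X]mxE.
  apply: cvgB; first exact: cvg_cst.
  apply: cvgM => //; apply: cvgM; first by apply: cvgM => //; exact: cvg_cst.
  by apply: cvgV => //; rewrite sqn_eq0.
have [k kP] : exists k, forall l,
    `|v 0 l - reflection (map_mx ratr (Q k)) (e0 R) 0 l| < d.
  have near_l l : \forall k \near \oo,
      `|v 0 l - reflection (map_mx ratr (Q k)) (e0 R) 0 l| < d.
    by have /cvgrPdist_lt/(_ d d0) := coordQ l.
  have [k _ /(_ k (leqnn k)) kP] := @filter_forall nat 'I_n.+1 (fun l =>
    [set k | `|v 0 l - reflection (map_mx ratr (Q k)) (e0 R) 0 l| < d]) \oo _ near_l.
  by exists k.
pose q : 'rV[rat]_n.+1 := \row_l ((l == 0)%:R -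
  2 * Q k 0 0 / (\sum_i Q k 0 i ^+ 2) * Q k 0 l).
have qE : map_mx ratr q = reflection (map_mx ratr (Q k)) (e0 R).
  apply/rowP => l; rewrite /reflection dot0 !mxE rmorphB !rmorphM fmorphV !rmorph_nat/=.
  congr (_ - 2 * _ / _ * _); rewrite rmorph_sum; apply: eq_bigr => i _.
  by rewrite mxE rmorphXn.
exists q; split; first by rewrite qE (reflection_isometry _).2 e01.
by move=> l; rewrite qE !mxE distrC; have := kP l; rewrite !mxE.
Unshelve. all: by end_near.
Qed.

End rational_unit_vectors.

(** * The lower bound for the number of colours *)

Lemma no_measurable_colouring (R : realType) (n : nat)
    (c : 'rV[R]_n.+2 -> 'I_(n.+2 + 2)) :
  (forall i, lebesgue_measurable [set x | c x = i]) ->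
  ~ (forall x y (q : 'rV[rat]_n.+2), y - x = map_mx ratr q -> sqn (y - x) = 1 ->
       c x <> c y).
Proof.
move=> mc proper.
have unit_flip v : sqn v = 1 -> lebesgue_outer_measure (~` flip c v) = 0%E.
  move=> v1; apply: outer_measure_unflip0 => // d d0.
  have [q [q1 qv]] := rational_unit_vector_near v1 d0.
  exists (map_mx ratr q) => // x.
  by apply: (proper _ _ q); rewrite addrAC subrr add0r.
case: n c mc proper unit_flip => [|n] c mc proper unit_flip.
  have [V VP] := @no_bichromatic_centre_2 R.
  have [i1 [i2 [kap [i12 kap1 kap2]]]] := bichromatic_centre mc unit_flip V.
  exact: VP i12 kap1 kap2.
have [V VP] := @no_bichromatic_centre_ge3 R n.
have [i1 [i2 [kap [i12 kap1 kap2]]]] := bichromatic_centre mc unit_flip V.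
exact: VP i12 kap1 kap2.
Qed.

Lemma card_leN_ordinal (T : pointedType) (C : set T) (k : nat) :
  ~ (`I_k.+1 #<= C)%card -> (C #<= `I_k)%card.
Proof.
move=> kC; have [finC|infC] := pselect (finite_set C).
  have /finite_setP[j Cj] := finC.
  rewrite (card_le_eql Cj) card_le_II leqNgt; apply/negP => kj; apply: kC.
  by rewrite (card_le_eqr Cj) card_le_II.
exfalso; apply: kC; apply: card_le_trans (subset_card_le (@subsetT _ _)) _.
by apply: contrapT => NC; apply: infC; apply/finite_setPn.
Qed.

Theorem theorem1 (R : realType) (K : {pred R}) (fieldK : GRing.divring_closed K)
    (QK : forall q : rat, ratr q \in K) (n : nat) (n_ge2 : (2 <= n)%N) :
  (forall C : set (set 'rV[R]_n),
     measurable_coloring (T_adj K) C -> (`I_(n + 3) #<= C)%card) /\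
  ((n + 3)%:R%:E <= measurable_chromatic_number (@T_adj R n K))%E.
Proof.
suff main : forall C : set (set 'rV[R]_n),
    measurable_coloring (T_adj K) C -> (`I_(n + 3) #<= C)%card.
  split => //; apply: le_ereal_inf_tmp => _ [C /main nC <-].
  rewrite /counting; case: asboolP => [finC|_]; last exact: leey.
  rewrite lee_fin ler_nat.
  have /finite_setP[k Ck] := finC.
  rewrite (card_fset_set Ck : size _ = k).
  by move: nC; rewrite (card_le_eqr Ck) card_le_II.
case: n n_ge2 => [//|[//|n]] _ C [[[coverC trivC neC] properC] mC].
(* In dimension [n.+2], too few classes give an injective numbering [g] of the classes by naturals
   below [n.+2 + 2]; [c] is the number of the class of a point. *)
apply: contrapT; rewrite addnS => /card_leN_ordinal/pcard_leP/unsquash g.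
have /choice[c cP] (x : 'rV[R]_n.+2) : exists i : 'I_(n.+2 + 2),
    exists S, [/\ C S, S x & g S = i :> nat].
  have [S CS Sx] : (\bigcup_(S in C) S) x by rewrite (_ : bigcup _ _ = setT).
  have gS : (g S < n.+2 + 2)%N by exact: (@funS _ _ _ _ g).
  by exists (Ordinal gS), S.
have g_inj S S' : C S -> C S' -> g S = g S' -> S = S'.
  by move=> CS CS' gSS'; apply: (@inj _ _ _ g) => //; rewrite inE.
have classE x S : C S -> S x -> g S = c x.
  have [S' [CS' S'x <-]] := cP x; move=> CS Sx; congr (g _).
  by apply: trivC => //; exists x.
apply: (@no_measurable_colouring R n c).
  move=> i; have [[S [CS Si]]|nS] := pselect (exists S, C S /\ g S = i :> nat).
    rewrite (_ : mkset _ = S); first exact: mC.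
    apply/seteqP; split => x /=.
      move=> cxi; have [S' [CS' S'x gS']] := cP x.
      by rewrite -(g_inj S' S)// gS' cxi.
    by move=> Sx; apply: val_inj; rewrite /= -(classE x S)// Si.
  (* A number that [g] does not take gives an empty colour set. *)
  rewrite (_ : mkset _ = set0); first exact: caratheodory_measurable_set0.
  apply/seteqP; split => // x /= cxi; apply: nS.
  by have [S [CS _ gS]] := cP x; exists S; rewrite gS cxi.
move=> x y q yxq yx1 cxy.
have [S [CS Sx gS]] := cP x; have [S' [CS' S'y gS']] := cP y.
have SS' : S = S' by apply: g_inj; rewrite // gS gS' cxy.
apply: (properC S CS x y) => //; first by rewrite SS'.
split; last by rewrite /euclidean_norm -/(sqn _) yx1 sqrtr1.
by rewrite yxq; apply/mxOverP => i j; rewrite mxE.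
Qed.
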